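(* Let $\rho:\mathcal{I}\to{\rm Spin}(7)$ be the inclusion. The pair $(\rho,\varepsilon)$ is unacceptable of type IIIb with respect to $\alpha$. Conversely, let $\Gamma$ be a group, $\chi:\Gamma\to\{\pm1\}$ a nontrivial character, and let $r:\Gamma\to{\rm Spin}(7)$ and $\eta:\Gamma\to\{\pm1\}$ be morphisms such that $(r,\eta)$ is unacceptable of type IIIb with respect to $\chi$. Then, up to replacing $r$ with a ${\rm Spin}(7)$-conjugate, there is a group morphism $f:\Gamma\to\mathcal{I}$ with $r=\rho\circ f$, $\chi=\alpha\circ f$ and $\eta=\varepsilon\circ f$.
   Context: Let $\pi:{\rm Spin}(7)\to{\rm SO}(7)$ be the canonical double cover (compact groups), with kernel $\{\pm1\}$, and let $E=\mathbb{R}^7$ be the standard representation of ${\rm Spin}(7)$ via $\pi$. A morphism $r:\Gamma\to{\rm Spin}(7)$ makes $E$ an $\mathbb{R}[\Gamma]$-module. Unacceptable pairs. For morphisms $r:\Gamma\to{\rm Spin}(7)$ and $\eta:\Gamma\to\{\pm1\}$, the pair $(r,\eta)$ is called unacceptable if $r(\gamma)$ and $\eta(\gamma)r(\gamma)$ are conjugate in ${\rm Spin}(7)$ for every $\gamma\in\Gamma$, but $r$ and $\eta r$ are not ${\rm Spin}(7)$-conjugate; otherwise it is called acceptable. ${\rm X}(r)$ denotes the group of characters $\psi:\Gamma\to\{\pm1\}$ for which there is $g\in{\rm Spin}(7)$ with $g\,r(\gamma)\,g^{-1}=\psi(\gamma)r(\gamma)$ for all $\gamma\in\Gamma$. Type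 III. Let $\chi:\Gamma\to\{\pm1\}$ be a nontrivial character with kernel $\Gamma_0$. A morphism $r:\Gamma\to{\rm Spin}(7)$ such that the $\mathbb{R}[\Gamma]$-module $E$ contains $\chi$ is called unacceptable of type III with respect to $\chi$ if $E$ does not contain the trivial representation of $\Gamma$ and there is an order $2$ character $\eta'$ of $\Gamma$ such that $(r,\eta')$ is unacceptable and $(r_{|\Gamma_0},\eta'_{|\Gamma_0})$ is acceptable. Type IIIb. Let $r$ be unacceptable of type III with respect to $\chi$, and write $E\simeq U\oplus\chi$ as an $\mathbb{R}[\Gamma]$-module. For an order $2$ character $\eta$ of $\Gamma$, the pair $(r,\eta)$ is called unacceptable of type IIIb with respect to $\chi$ if $\eta\notin{\rm X}(r)$ and there is an $\mathbb{R}[\Gamma_0]$-submodule $V_0\subset U$ (not necessarily irreducible) with $\dim V_0=3$ and determinant $\eta_{|\Gamma_0}$, such that $U\simeq{\rm Ind}_{\Gamma_0}^{\Gamma}V_0$ as $\mathbb{R}[\Gamma]$-modules. The group $\mathcal{I}$. Fix an orthogonal decomposition $\mathbb{R}^7=L\perp F$ with $L$ a line, and let $N\subset{\rm Spin}(7)$ be the inverse image under $\pi$ of the stabilizer of $L$; restriction to $F$ gives a surjection $N\to{\rm O}(F)$ with kernel $\{\pm1\}$. Fix an orthogonal decomposition $F=T\perp T'$ with $\dim T=\dim T'=3$. Let $\underline{\mathcal{I}}\subset{\rm O}(F)$ be the subgroup of isometries that preserve the pair $\{T,T'\}$ and whose signature as a permutation of $\{T,T'\}$ coincides with their determinant on $F$.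 Let $\alpha:\underline{\mathcal{I}}\to\{\pm1\}$ be the determinant on $F$, and $\underline{\mathcal{I}}_0=\ker\alpha$. Let $\varepsilon:\underline{\mathcal{I}}\to\{\pm1\}$ be any of the two characters of $\underline{\mathcal{I}}$ which coincide with $\det T=\det T'$ on $\underline{\mathcal{I}}_0$ (the other one is $\alpha\varepsilon$). Then $\mathcal{I}\subset N\subset{\rm Spin}(7)$ is the inverse image of $\underline{\mathcal{I}}$ under $N\to{\rm O}(F)$, and $\alpha$, $\varepsilon$ are viewed as characters of $\mathcal{I}$ by inflation. *)

(* Defs.v *)
From HB Require Import structures.
From mathcomp Require Import all_boot all_order all_algebra ring.
From mathcomp Require Import falgebra.
From mathcomp Require Import boolp functions reals.
Set Implicit Arguments.
Unset Strict Implicit.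
Unset Printing Implicit Defensive.
Import Order.TTheory GRing.Theory Num.Theory.
Local Open Scope ring_scope.

Section CliffordSigns.
Variables (R : realType) (n : nat).
Implicit Types S T U : {set 'I_n}.

Definition symdiff S T : {set 'I_n} := [set i | (i \in S) (+) (i \in T)].

Definition clsign S T : R :=
  \prod_(i in S) \prod_(j in T | (j < i)%N) (-1).

Lemma symdiffA : associative symdiff.
Proof. by move=> A B C; apply/setP=> i; rewrite !inE addbA. Qed.
Lemma symdiff0s : left_id set0 symdiff.
Proof. by move=> A; apply/setP=> i; rewrite !inE. Qed.
Lemma symdiffs0 : right_id set0 symdiff.
Proof. by move=> A; apply/setP=> i; rewrite !inE addbF. Qed.
Lemma symdiffss S : symdiff S S = set0.
Proof. by apply/setP=> i; rewrite !inE addbb. Qed.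
Lemma symdiffC : commutative symdiff.
Proof. by move=> A B; apply/setP=> i; rewrite !inE addbC. Qed.
Lemma symdiffK S : involutive (symdiff S).
Proof. by move=> T; rewrite symdiffA symdiffss symdiff0s. Qed.

Lemma prod_symdiff S T (P : pred 'I_n) (f : 'I_n -> R) :
  (forall i, f i * f i = 1) ->
  \prod_(i in symdiff S T | P i) f i =
  (\prod_(i in S | P i) f i) * \prod_(i in T | P i) f i.
Proof.
move=> f2; rewrite big_mkcond [X in _ = X * _]big_mkcond.
rewrite [X in _ = _ * X]big_mkcond -big_split /=.
apply: eq_bigr => i _; rewrite inE.
by case: (i \in S); case: (i \in T); case: (P i); rewrite ?mulr1 ?mul1r ?f2.
Qed.

Lemma sq_prodN1 T (P : pred 'I_n) :
  (\prod_(j in T | P j) (-1 : R)) * (\prod_(j in T | P j) (-1)) = 1.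
Proof. by rewrite -big_split /= big1 // => j _; rewrite mulrNN mulr1. Qed.

Lemma clsignDl A B C : clsign (symdiff A B) C = clsign A C * clsign B C.
Proof.
rewrite /clsign; pose f (i : 'I_n) : R := \prod_(j in C | (j < i)%N) (-1).
have e X : \prod_(i in X) f i = \prod_(i in X | predT i) f i.
  by apply: eq_bigl => i; rewrite andbT.
rewrite -!/(\prod_(i in _) f i) !e.
by apply: prod_symdiff => i; apply: sq_prodN1.
Qed.

Lemma clsignDr A B C : clsign A (symdiff B C) = clsign A B * clsign A C.
Proof.
rewrite /clsign -big_split; apply: eq_bigr => i _ /=.
by apply: prod_symdiff => j; rewrite mulrNN mulr1.
Qed.

Lemma clsign0l A : clsign set0 A = 1.
Proof. by rewrite /clsign big_set0. Qed.
Lemma clsign0r A : clsign A set0 = 1.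
Proof.
by rewrite /clsign big1 // => i _; rewrite big_pred0 // => j; rewrite inE.
Qed.

End CliffordSigns.
Arguments symdiff {n}.

(* The Clifford algebra of the Euclidean space R^n, with v^2 = |v|^2. It has    *)
(* the basis e_S = e_{i_1} ... e_{i_k} for S = {i_1 < ... < i_k}, and an        *)
(* element is given by its coordinates. The Clifford relations e_i^2 = 1,       *)
(* e_i e_j = - e_j e_i give e_S e_T = clsign S T e_{S Delta T}: one sign for    *)
(* each pair i in S, j in T with j < i.                                         *)
Definition clifford (R : realType) (n : nat) : Type :=
  {ffun {set 'I_n} -> R^o}.

Section CliffordAlgebra.
Variables (R : realType) (n : nat).
Local Notation Cl := (clifford R n).

HB.instance Definition _ := Vector.copy Cl {ffun {set 'I_n} -> R^o}.

Implicit Types (x y z : Cl) (S T U : {set 'I_n}).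

Definition cle S : Cl := [ffun U => (U == S)%:R].

Definition clmul x y : Cl :=
  [ffun U => \sum_S clsign R S (symdiff S U) * (x S * y (symdiff S U))].

Fact clmulA : associative clmul.
Proof.
move=> x y z; apply/ffunP=> U; rewrite !ffunE.
under eq_bigr => S _.
  rewrite ffunE (reindex_inj (inv_inj (symdiffK S))) /= !mulr_sumr.
  over.
rewrite exchange_big /=; apply: eq_bigr => V _.
rewrite !ffunE mulr_suml mulr_sumr; apply: eq_bigr => S _.
have -> : symdiff (symdiff S V) (symdiff S U) = symdiff V U.
  by rewrite [symdiff S V]symdiffC -symdiffA symdiffK.
have e : clsign R S (symdiff S U) * clsign R (symdiff S V) (symdiff V U)
     = clsign R V (symdiff V U) * clsign R S (symdiff S V).
  have -> : symdiff S U = symdiff (symdiff S V) (symdiff V U).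
    by rewrite -symdiffA symdiffK.
  by rewrite clsignDr -mulrA -clsignDl symdiffK mulrC.
transitivity (clsign R S (symdiff S U) * clsign R (symdiff S V) (symdiff V U)
              * (x S * (y (symdiff S V) * z (symdiff V U)))).
  by rewrite -[RHS]mulrA; congr (_ * _); rewrite mulrCA.
by rewrite e -!mulrA.
Qed.

Fact clmul1x : left_id (cle set0) clmul.
Proof.
move=> x; apply/ffunP=> U; rewrite ffunE (bigD1 set0) //= big1 => [|S /negPf S0].
  by rewrite ffunE eqxx clsign0l symdiff0s !mul1r addr0.
by rewrite ffunE S0 mul0r mulr0.
Qed.

Fact clmulx1 : right_id (cle set0) clmul.
Proof.
move=> x; apply/ffunP=> U; rewrite ffunE (bigD1 U) //= big1 => [|S SU].
  by rewrite symdiffss ffunE eqxx clsign0r mul1r mulr1 addr0.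
rewrite ffunE [_ == set0](_ : _ = false) ?mulr0 //.
apply/negP=> /eqP e; case/eqP: SU.
by rewrite -[U](symdiffK S) e symdiffs0.
Qed.

Fact clmulDl : left_distributive clmul +%R.
Proof.
move=> x y z; apply/ffunP=> U; rewrite !ffunE -big_split /=.
by apply: eq_bigr => S _; rewrite ffunE mulrDl mulrDr.
Qed.

Fact clmulDr : right_distributive clmul +%R.
Proof.
move=> x y z; apply/ffunP=> U; rewrite !ffunE -big_split /=.
by apply: eq_bigr => S _; rewrite ffunE !mulrDr.
Qed.

Fact cle0_neq0 : cle set0 != 0.
Proof.
by apply/eqP=> /ffunP/(_ set0)/eqP; rewrite !ffunE eqxx oner_eq0.
Qed.

HB.instance Definition _ := GRing.Zmodule_isNzRing.Build Cl
  clmulA clmul1x clmulx1 clmulDl clmulDr cle0_neq0.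

Fact clmulZl (a : R) x y : a *: (x * y) = (a *: x) * y.
Proof.
apply/ffunP=> U; rewrite !ffunE /= [LHS]mulr_sumr.
by apply: eq_bigr => S _; rewrite ffunE mulrCA -mulrA.
Qed.

HB.instance Definition _ := GRing.Lmodule_isLalgebra.Build R Cl clmulZl.

Fact clmulZr (a : R) x y : a *: (x * y) = x * (a *: y).
Proof.
apply/ffunP=> U; rewrite !ffunE /= [LHS]mulr_sumr.
apply: eq_bigr => S _; rewrite ffunE [LHS]mulrCA; congr (_ * _).
by rewrite [LHS]mulrCA.
Qed.

HB.instance Definition _ := GRing.Lalgebra_isAlgebra.Build R Cl clmulZr.
HB.instance Definition _ := Algebra_isFalgebra.Build R Cl.

Lemma cleM S T : cle S * cle T = clsign R S T *: cle (symdiff S T).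
Proof.
apply/ffunP=> U; rewrite ffunE (bigD1 S) //= big1 => [|V /negPf VS].
  rewrite !ffunE eqxx mul1r addr0 -(inj_eq (inv_inj (symdiffK S))) symdiffK.
  by case: eqP => [->|_]; rewrite ?symdiffK // mulr0 scaler0.
by rewrite [cle S V]ffunE VS mul0r mulr0.
Qed.

Definition clvec (v : 'cV[R]_n) : Cl := \sum_i v i 0 *: cle [set i].

End CliffordAlgebra.

Definition dotp (R : realType) (n : nat) (u v : 'cV[R]_n) : R :=
  \sum_i u i 0 * v i 0.

Section CliffordVectors.
Variables (R : realType) (n : nat).
Local Notation Cl := (clifford R n).
Implicit Types (u v w : 'cV[R]_n) (s : seq 'cV[R]_n).

Fact clvec_is_linear : linear (@clvec R n).
Proof.
move=> a v w; rewrite /clvec scaler_sumr -big_split /=.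
by apply: eq_bigr => i _; rewrite !mxE scalerDl scalerA.
Qed.
HB.instance Definition _ :=
  GRing.isLinear.Build R 'cV[R]_n Cl _ (@clvec R n) clvec_is_linear.

Lemma clvecE v (i : 'I_n) : clvec v [set i] = v i 0.
Proof.
rewrite /clvec sum_ffunE (bigD1 i) //= big1 => [|j ji].
  by rewrite !ffunE eqxx addr0 [LHS]mulr1.
rewrite !ffunE (inj_eq set1_inj) eq_sym (negPf ji); exact: mulr0.
Qed.

Lemma clvec_delta (j : 'I_n) : clvec (delta_mx j 0) = cle R [set j].
Proof.
rewrite /clvec (bigD1 j) //= big1 => [|i ij]; first by rewrite mxE !eqxx scale1r addr0.
by rewrite mxE (negPf ij) scale0r.
Qed.

Lemma clsign1 (i j : 'I_n) : clsign R [set i] [set j] = (-1) ^+ (j < i)%N.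
Proof.
by rewrite /clsign big_set1 big_mkcondr big_set1 /=; case: ltnP.
Qed.

Lemma cle_anticomm (i j : 'I_n) :
  cle R [set i] * cle R [set j] + cle R [set j] * cle R [set i]
  = ((i == j)%:R *+ 2)%:A :> Cl.
Proof.
rewrite !cleM [symdiff [set j] _]symdiffC -scalerDl !clsign1.
case: eqP => [->|/eqP ij]; first by rewrite symdiffss ltnn.
rewrite mul0rn scale0r; move: ij; rewrite -val_eqE /= neq_ltn.
by case: ltngtP => //= _ _; rewrite ?subrr ?addNr scale0r.
Qed.

Lemma clvec_anticomm u v :
  clvec u * clvec v + clvec v * clvec u = (dotp u v *+ 2)%:A :> Cl.
Proof.
have E a b : clvec a * clvec b =
    \sum_i \sum_j (a i 0 * b j 0) *: (cle R [set i] * cle R [set j]) :> Cl.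
  rewrite /clvec mulr_suml; apply: eq_bigr => i _.
  rewrite mulr_sumr; apply: eq_bigr => j _.
  by rewrite -scalerAl -scalerAr scalerA.
rewrite !E [X in _ + X]exchange_big -big_split /= /dotp -sumrMnl scaler_suml.
apply: eq_bigr => i _; rewrite -big_split /= (bigD1 i) //= big1 => [|j ji].
  rewrite addr0 [v i 0 * _]mulrC -scalerDr cle_anticomm eqxx scalerA.
  by rewrite mulrnAr mulr1.
rewrite [v j 0 * _]mulrC -scalerDr cle_anticomm eq_sym (negPf ji).
by rewrite mul0rn scale0r scaler0.
Qed.

Lemma clvec_sqr v : clvec v * clvec v = (dotp v v)%:A :> Cl.
Proof.
have := clvec_anticomm v v; rewrite -mulr2n -scalerMnl -!scaler_nat.
by apply: scalerI; rewrite pnatr_eq0.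
Qed.

Lemma dotpE u v : dotp u v = (u^T *m v) 0 0.
Proof. by rewrite !mxE; apply: eq_bigr => i _; rewrite mxE. Qed.

Definition unitvec v := dotp v v == 1.

(* The linear map v |-> u v u on vectors, for a unit vector u. *)
Definition vecflip u : 'M[R]_n := 2%:R *: (u *m u^T) - 1%:M.

Lemma clvec_flip u v : unitvec u ->
  clvec u * clvec v * clvec u = clvec (vecflip u *m v) :> Cl.
Proof.
move=> /eqP u1; have /(canRL (addrK _)) -> := clvec_anticomm u v.
rewrite mulrBl -mulrA clvec_sqr u1 scale1r mulr1 /vecflip mulmxBl mul1mx.
rewrite linearB /=; congr (_ - _); rewrite -scalemxAl -mulmxA.
have -> : u^T *m v = (dotp u v)%:M.
  by rewrite dotpE; apply/matrixP=> i j; rewrite !ord1 [RHS]mxE eqxx mulr1n.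
rewrite mul_mx_scalar scalerA mulr_natl linearZ /=.
by rewrite -scalerAl mul1r.
Qed.

Lemma vecflip_ortho u : unitvec u -> (vecflip u)^T *m vecflip u = 1%:M.
Proof.
move=> /eqP u1; have uu : u^T *m u = 1%:M.
  apply/matrixP=> i j; rewrite !ord1 -dotpE u1 mxE eqxx //.
have -> : (vecflip u)^T = vecflip u.
  by rewrite /vecflip linearB linearZ /= trmx_mul trmxK trmx1.
rewrite {1}/vecflip mulmxBl mul1mx -scalemxAl /vecflip mulmxBr mulmx1.
rewrite -scalemxAr -[u *m u^T *m _]mulmxA [u^T *m (_ *m _)]mulmxA uu mul1mx.
rewrite scalerBr scalerA opprB addrA -addrA; apply/matrixP=> i j.
rewrite !mxE; ring.
Qed.

Lemma det_vecflip u : unitvec u -> \det (vecflip u) = - (-1) ^+ n.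
Proof.
move=> /eqP u1; pose w := 2%:R *: u.
have uw : u^T *m w = 2%:R%:M.
  apply/matrixP=> i j; rewrite !ord1 /w -scalemxAr mxE -dotpE u1 mulr1.
  by rewrite mxE eqxx.
pose B : 'M[R]_(1 + n) := block_mx 1%:M u^T w 1%:M.
have B1 : \det B = \det (1%:M - w *m u^T).
  have -> : B = block_mx 1%:M 0 w 1%:M *m block_mx 1%:M u^T 0 (1%:M - w *m u^T).
    rewrite mulmx_block !(mul1mx, mul0mx, mulmx1, mulmx0, addr0, add0r).
    by rewrite addrC subrK.
  by rewrite det_mulmx det_lblock det_ublock !det1 !mul1r.
have B2 : \det B = -1.
  have -> : B = block_mx 1%:M u^T 0 1%:M *m block_mx (1%:M - u^T *m w) 0 w 1%:M.
    rewrite mulmx_block !(mul1mx, mul0mx, mulmx1, mulmx0, addr0, add0r).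
    by rewrite subrK.
  rewrite det_mulmx det_lblock det_ublock !det1 !mul1r mulr1 uw det_mx11 !mxE.
  by rewrite eqxx /= mulr1n; ring.
have -> : vecflip u = -1 *: (1%:M - w *m u^T).
  by rewrite /vecflip scaleN1r opprB /w -scalemxAl.
by rewrite detZ -B1 B2 mulrN1.
Qed.

(* Spin(n) is the group of products of an even number of unit vectors. *)
Definition spin_pred : {pred Cl} := [pred x | `[<
  exists s, [/\ all unitvec s, ~~ odd (size s) & x = \prod_(v <- s) clvec v] >]].

Lemma spin_mul x y : x \in spin_pred -> y \in spin_pred -> x * y \in spin_pred.
Proof.
move=> /asboolP[s [us os ->]] /asboolP[t [ut ot ->]]; apply/asboolP.
exists (s ++ t); rewrite all_cat us ut size_cat oddD (negPf os) (negPf ot).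
by rewrite big_cat.
Qed.

Lemma spin_one : 1 \in spin_pred.
Proof. by apply/asboolP; exists [::]; rewrite big_nil. Qed.

Lemma prod_clvec_rev s : all unitvec s ->
  (\prod_(v <- s) clvec v) * (\prod_(v <- rev s) clvec v) = 1 :> Cl.
Proof.
elim: s => [_|v s IH /= /andP[/eqP v1 us]]; first by rewrite !big_nil mulr1.
rewrite rev_cons big_cons big_rcons /= mulrA -[_ * _ * \prod_(_ <- _) _]mulrA IH //.
by rewrite mulr1 clvec_sqr v1 scale1r.
Qed.

Lemma spin_inv_subproof s : all unitvec s ->
  (\prod_(v <- s) clvec v : Cl)^-1 = \prod_(v <- rev s) clvec v.
Proof.
move=> us; have e := prod_clvec_rev us.
have e' : (\prod_(v <- rev s) clvec v) * (\prod_(v <- s) clvec v) = 1 :> Cl.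
  by rewrite -[in X in _ * X = _](revK s) prod_clvec_rev ?all_rev.
have U : (\prod_(v <- s) clvec v : Cl) \is a GRing.unit 
  by apply/unitrP; exists (\prod_(v <- rev s) clvec v).
by apply: (mulrI U); rewrite divrr.
Qed.

Lemma spin_inv x : x \in spin_pred -> x^-1 \in spin_pred.
Proof.
move=> /asboolP[s [us os ->]]; apply/asboolP; exists (rev s).
by rewrite all_rev size_rev spin_inv_subproof.
Qed.

Lemma spin_unit x : x \in spin_pred -> x \is a GRing.unit.
Proof.
move=> /asboolP[s [us os ->]]; apply/unitrP; exists (\prod_(v <- rev s) clvec v).
split; last exact: prod_clvec_rev.
by rewrite -[in X in _ * X = _](revK s) prod_clvec_rev ?all_rev.
Qed.

End CliffordVectors.

Record spin (R : realType) (n : nat) :=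
  Spin { spin_val :> clifford R n; spin_valP : spin_val \in @spin_pred R n }.

Section SpinGroup.
Variables (R : realType) (n : nat).
HB.instance Definition _ := [isSub for @spin_val R n].
HB.instance Definition _ := [Choice of spin R n by <:].
Implicit Types x y : spin R n.

Definition spin1 : spin R n := Spin (@spin_one R n).
Definition spinM x y : spin R n := Spin (spin_mul (valP x) (valP y)).
Definition spinV x : spin R n := Spin (spin_inv (valP x)).

Fact spinMA : associative spinM.
Proof. by move=> x y z; apply/val_inj; exact: mulrA. Qed.
Fact spin1M : left_id spin1 spinM.
Proof. by move=> x; apply/val_inj; exact: mul1r. Qed.
Fact spinM1 : right_id spin1 spinM.
Proof. by move=> x; apply/val_inj; exact: mulr1. Qed.
Fact spinVM : left_inverse spin1 spinV spinM.
Proof. by move=> x; apply/val_inj; apply: mulVr; exact: spin_unit (valP x). Qed.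
Fact spinMV : right_inverse spin1 spinV spinM.
Proof. by move=> x; apply/val_inj; apply: divrr; exact: spin_unit (valP x). Qed.
HB.instance Definition _ := isGroup.Build (spin R n) spinMA spin1M spinM1 spinVM spinMV.
End SpinGroup.

Record orthogonal (R : realType) (n : nat) := Orthogonal
  { ortho_val :> 'M[R]_n; _ : ortho_val^T *m ortho_val == 1%:M }.

Section OrthogonalGroup.
Variables (R : realType) (n : nat).
HB.instance Definition _ := [isSub for @ortho_val R n].
HB.instance Definition _ := [Choice of orthogonal R n by <:].
Implicit Types A B : orthogonal R n.

Fact ortho1_subproof : (1%:M : 'M[R]_n)^T *m 1%:M == 1%:M.
Proof. by rewrite trmx1 mulmx1. Qed.
Fact orthoM_subproof A B : (A *m B)^T *m (A *m B) == 1%:M.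
Proof.
by rewrite trmx_mul mulmxA -[_ *m A]mulmxA (eqP (valP A)) mulmx1 (eqP (valP B)).
Qed.
Fact orthoV_subproof A : (A^T)^T *m A^T == 1%:M.
Proof. by rewrite trmxK; apply/eqP/mulmx1C/eqP/(valP A). Qed.

Definition ortho1 := Orthogonal ortho1_subproof.
Definition orthoM A B := Orthogonal (orthoM_subproof A B).
Definition orthoV A := Orthogonal (orthoV_subproof A).

Fact orthoMA : associative orthoM.
Proof. by move=> A B C; apply/val_inj; exact: mulmxA. Qed.
Fact ortho1M : left_id ortho1 orthoM.
Proof. by move=> A; apply/val_inj; exact: mul1mx. Qed.
Fact orthoM1 : right_id ortho1 orthoM.
Proof. by move=> A; apply/val_inj; exact: mulmx1. Qed.
Fact orthoVM : left_inverse ortho1 orthoV orthoM.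
Proof. by move=> A; apply/val_inj/eqP/(valP A). Qed.
Fact orthoMV : right_inverse ortho1 orthoV orthoM.
Proof. by move=> A; apply/val_inj/mulmx1C/eqP/(valP A). Qed.
HB.instance Definition _ :=
  isGroup.Build (orthogonal R n) orthoMA ortho1M orthoM1 orthoVM orthoMV.
End OrthogonalGroup.

Section SpinCover.
Variables (R : realType) (n : nat).
Implicit Types x y : spin R n.

(* The double cover Spin(n) -> SO(n): x acts on R^n by v |-> x v x^-1; the      *)
(* matrix acts on column vectors. Its determinant is 1 (det_spin_cover).        *)
Definition spin_cover_mx x : 'M[R]_n :=
  \matrix_(i, j) ((x : clifford R n) * cle R [set j] * (x : clifford R n)^-1) [set i].

Lemma clvec_inj : injective (@clvec R n).
Proof. by move=> v w e; apply/colP=> i; rewrite -!clvecE e. Qed.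

Lemma spin_cover_ex x : exists A : 'M[R]_n,
  [/\ A^T *m A = 1%:M, \det A = 1
    & forall v, (x : clifford R n) * clvec v * (x : clifford R n)^-1
                = clvec (A *m v)].
Proof.
have /asboolP[s [us os ->]] := valP x.
suff [A [A1 dA H]] : exists A : 'M[R]_n, [/\ A^T *m A = 1%:M,
    \det A = (- (-1) ^+ n) ^+ size s
  & forall v, (\prod_(v <- s) clvec v) * clvec v * (\prod_(v <- rev s) clvec v)
              = clvec (A *m v) :> clifford R n].
  exists A; split=> // [|v]; last by rewrite spin_inv_subproof.
  rewrite dA exprNn -signr_odd (negPf os) mul1r -exprM -signr_odd oddM (negPf os).
  by rewrite andbF.
elim: s us {os} => [_|u s IH /= /andP[u1 us]].
  exists 1%:M; rewrite trmx1 mulmx1 det1 expr0; split=> // v.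
  by rewrite !big_nil mul1r mulr1 mul1mx.
have [A [A1 dA H]] := IH us; exists (vecflip u *m A); split.
- rewrite trmx_mul mulmxA -[_ *m vecflip u]mulmxA vecflip_ortho //.
  by rewrite mulmx1.
- by rewrite det_mulmx dA det_vecflip // exprS.
- move=> v; rewrite rev_cons big_cons big_rcons /=.
  by rewrite -mulmxA -clvec_flip // -H !mulrA.
Qed.

Lemma spin_coverP x (v : 'cV[R]_n) :
  (x : clifford R n) * clvec v * (x : clifford R n)^-1 = clvec (spin_cover_mx x *m v).
Proof.
have [A [_ _ H]] := spin_cover_ex x; rewrite H; congr (clvec (_ *m _)).
by apply/matrixP=> i j; rewrite mxE -clvec_delta H clvecE -colE mxE.
Qed.

Lemma spin_cover_uniq x (A : 'M[R]_n) :
  (forall v, (x : clifford R n) * clvec v * (x : clifford R n)^-1 = clvec (A *m v)) ->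
  spin_cover_mx x = A.
Proof.
by move=> H; apply/matrixP=> i j; rewrite mxE -clvec_delta H clvecE -colE mxE.
Qed.

Fact spin_cover_subproof x : (spin_cover_mx x)^T *m spin_cover_mx x == 1%:M.
Proof. by have [A [/eqP A1 _ /spin_cover_uniq ->]] := spin_cover_ex x. Qed.

Lemma det_spin_cover x : \det (spin_cover_mx x) = 1.
Proof. by have [A [_ A1 /spin_cover_uniq ->]] := spin_cover_ex x. Qed.

Definition spin_cover x : orthogonal R n := Orthogonal (spin_cover_subproof x).

Fact spin_coverM : {morph spin_cover : x y / (x * y)%g}.
Proof.
move=> x y; apply/val_inj/spin_cover_uniq => v /=.
rewrite -mulmxA -!spin_coverP invrM ?spin_unit ?spin_valP //.
by rewrite !mulrA.
Qed.
HB.instance Definition _ :=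
  isMultiplicative.Build (spin R n) (orthogonal R n) spin_cover spin_coverM.

End SpinCover.

(* The group {1, -1}, multiplicatively: true stands for -1 and false for 1.     *)
Definition pm1 : Type := bool.
HB.instance Definition _ := Choice.copy pm1 bool.
HB.instance Definition _ :=
  isGroup.Build pm1 addbA addFb addbF addbb addbb.

Definition pmval (R : pzRingType) (b : pm1) : R := (-1) ^+ (b : bool).

Lemma pmvalM (R : pzRingType) : {morph @pmval R : a b / (a * b)%g >-> a * b}.
Proof. by move=> a b; exact: signr_addb. Qed.

Definition trivial_char (G : groupType) : {multiplicative G -> pm1} :=
  @one_fun G pm1.

(* A character of order 2, that is, a nontrivial one. *)
Definition nontrivial (G : groupType) (chi : {multiplicative G -> pm1}) :=
  exists g, chi g <> 1%g.

Lemma gmorph1 (G H : groupType) (f : {multiplicative G -> H}) : f 1%g = 1%g.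
Proof. by apply: (mulgI (f 1%g)); rewrite -gmulfM !mulg1. Qed.

Section Kernel.
Variables (G H : groupType) (f : {multiplicative G -> H}).

Definition ker_pred : {pred G} := [pred g | f g == 1%g].

Lemma ker_closed : group_closed ker_pred.
Proof.
split; first by rewrite inE gmorph1.
move=> x y; rewrite !inE => /eqP fx /eqP fy.
have : f (x / y * y)%g = 1%g by rewrite mulgVK.
by rewrite gmulfM fy mulg1 => ->.
Qed.

Record ker := Ker { ker_val :> G; _ : ker_val \in ker_pred }.
HB.instance Definition _ := [isSub for ker_val].
HB.instance Definition _ := [Choice of ker by <:].
HB.instance Definition _ := SubChoice_isSubGroup.Build G ker_pred ker ker_closed.

Definition restr_ker (K : groupType) (h : {multiplicative G -> K}) :
  {multiplicative ker -> K} := (h \o (val : ker -> G)).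
End Kernel.

Section Representations.
Variable R : realType.

(* A real representation of G, that is, an R[G]-module. *)
Record repr (G : groupType) := Repr {
  repr_car :> lmodType R;
  ract : G -> {linear repr_car -> repr_car};
  ract1 : forall v, ract 1%g v = v;
  ractM : forall g h v, ract (g * h)%g v = ract g (ract h v)
}.

Definition rhom (G : groupType) (V W : repr G) (f : {linear V -> W}) :=
  forall g v, f (ract V g v) = ract W g (f v).

(* W is isomorphic to a submodule of V. *)
Definition contains (G : groupType) (V W : repr G) :=
  exists f : {linear W -> V}, rhom f /\ injective f.

Definition risom (G : groupType) (V W : repr G) :=
  exists f : {linear V -> W}, rhom f /\ bijective f.

Record mxrepr (G : groupType) (n : nat) := MxRepr {
  mxr :> G -> 'M[R]_n;
  mxr1 : mxr 1%g = 1%:M;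
  mxrM : forall g h, mxr (g * h)%g = mxr g *m mxr h
}.

Section MatrixModule.
Variables (G : groupType) (n : nat) (s : mxrepr G n).
Definition mxr_act (g : G) : {linear 'cV[R]_n -> 'cV[R]_n} := mulmx (s g).
Fact mxr_act1 v : mxr_act 1%g v = v.
Proof. by rewrite /= mxr1 mul1mx. Qed.
Fact mxr_actM g h v : mxr_act (g * h)%g v = mxr_act g (mxr_act h v).
Proof. by rewrite /= mxrM mulmxA. Qed.
Definition mxmodule : repr G := Repr mxr_act1 mxr_actM.
End MatrixModule.

Section CharacterModule.
Variables (G : groupType) (chi : {multiplicative G -> pm1}).
Definition char_act (g : G) : {linear R^o -> R^o} := *:%R (pmval R (chi g)).
Fact char_act1 v : char_act 1%g v = v.
Proof. by rewrite /= gmorph1 [LHS]scale1r. Qed.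
Fact char_actM g h v : char_act (g * h)%g v = char_act g (char_act h v).
Proof. by rewrite /= gmulfM pmvalM scalerA. Qed.
Definition charmodule : repr G := Repr char_act1 char_actM.
End CharacterModule.

Section DirectSum.
Variables (G : groupType) (V W : repr G).
Definition rsum_fun (g : G) (x : V * W) : V * W := (ract V g x.1, ract W g x.2).
Fact rsum_is_linear g : linear (rsum_fun g).
Proof. by move=> a x y; rewrite /rsum_fun /= !linearP. Qed.
HB.instance Definition _ g :=
  GRing.isLinear.Build R (V * W)%type (V * W)%type _ (rsum_fun g) (rsum_is_linear g).
Definition rsum_act (g : G) : {linear (V * W)%type -> (V * W)%type} := rsum_fun g.
Fact rsum_act1 x : rsum_act 1%g x = x.
Proof. by case: x => v w; rewrite /= /rsum_fun /= !ract1. Qed.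
Fact rsum_actM g h x : rsum_act (g * h)%g x = rsum_act g (rsum_act h x).
Proof. by rewrite /= /rsum_fun /= !ractM. Qed.
Definition rsum : repr G := Repr rsum_act1 rsum_actM.
End DirectSum.

Section Restriction.
Variables (H G : groupType) (i : {multiplicative H -> G}) (V : repr G).
Fact res_act1 v : ract V (i 1%g) v = v.
Proof. by rewrite gmorph1 ract1. Qed.
Fact res_actM g h v : ract V (i (g * h)%g) v = ract V (i g) (ract V (i h) v).
Proof. by rewrite gmulfM ractM. Qed.
Definition rres : repr H := @Repr H V (fun h => ract V (i h)) res_act1 res_actM.
End Restriction.

(* The representation of G induced from the subgroup i : H -> G, as the space   *)
(* of functions f : G -> V with f (h x) = h (f x), where g acts by right        *)
(* translation. This is R[G] (x)_{R[H]} V when H has finite index in G, and     *)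
(* here only subgroups of index 2 occur.                                        *)
Section Induction.
Variables (H G : groupType) (i : {multiplicative H -> G}) (V : repr H).

Definition ind_pred : {pred G -> V} := [pred f : G -> V |
  `[< forall (h : H) (x : G), f (i h * x)%g = ract V h (f x) >]].

Fact ind_submod_closed : submod_closed ind_pred.
Proof.
split; first by apply/asboolP=> h x; exact: esym (linear0 (ract V h)).
move=> a f g /asboolP fi /asboolP gi; apply/asboolP=> h x.
rewrite [LHS](_ : _ = a *: f (i h * x)%g + g (i h * x)%g) // fi gi.
by rewrite -linearP.
Qed.
HB.instance Definition _ :=
  GRing.isSubmodClosed.Build R (G -> V) ind_pred ind_submod_closed.

Record ind_fun := IndFun { ind_val :> G -> V; _ : ind_val \in ind_pred }.
HB.instance Definition _ := [isSub for ind_val].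
HB.instance Definition _ := [Choice of ind_fun by <:].
HB.instance Definition _ := [SubChoice_isSubLmodule of ind_fun by <:].

Fact ind_trans_subproof (g : G) (f : ind_fun) :
  (fun x => f (x * g)%g) \in ind_pred.
Proof.
apply/asboolP=> h x; rewrite -mulgA.
by case: f => f /= /asboolP ->.
Qed.
Definition ind_trans (g : G) (f : ind_fun) : ind_fun :=
  IndFun (ind_trans_subproof g f).
Fact ind_trans_is_linear g : linear (ind_trans g).
Proof. by move=> a f1 f2; apply/val_inj. Qed.
HB.instance Definition _ g :=
  GRing.isLinear.Build R ind_fun ind_fun _ (ind_trans g) (ind_trans_is_linear g).
Definition ind_act (g : G) : {linear ind_fun -> ind_fun} := ind_trans g.
Fact ind_act1 f : ind_act 1%g f = f.
Proof. by apply/val_inj/funext=> x /=; rewrite mulg1. Qed.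
Fact ind_actM g h f : ind_act (g * h)%g f = ind_act g (ind_act h f).
Proof. by apply/val_inj/funext=> x /=; rewrite mulgA. Qed.
Definition rind : repr G := Repr ind_act1 ind_actM.
End Induction.

End Representations.

Section Conjugacy.
Variables (K G : groupType).
Definition conjugate (x y : K) := exists k, y = (k * x * k^-1)%g.
Definition hom_conjugate (r s : {multiplicative G -> K}) :=
  exists k, forall g, s g = (k * r g * k^-1)%g.
End Conjugacy.

Section SpinSeven.
Variable R : realType.
Local Notation Spin7 := (spin R 7).

Fact spin_sign_subproof (b : pm1) : pmval (clifford R 7) b \in @spin_pred R 7.
Proof.
case: b; last exact: spin_one.
have e1 : dotp (delta_mx 0 0 : 'cV[R]_7) (delta_mx 0 0) = 1.
  rewrite /dotp (bigD1 0) //= big1 => [|i /negPf i0]; rewrite !mxE /=.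
    by rewrite mulr1 addr0.
  by rewrite i0 mul0r.
apply/asboolP; exists [:: delta_mx 0 0; - delta_mx 0 0]; split=> //=.
  have e2 : unitvec (- delta_mx 0 0 : 'cV[R]_7).
    rewrite /unitvec /dotp -e1; apply/eqP/eq_bigr => i _.
    by rewrite !mxE mulrNN.
  by rewrite e2 /unitvec e1 eqxx.
rewrite big_cons big_seq1 linearN /= mulrN clvec_sqr e1 scale1r.
by rewrite /pmval expr1.
Qed.

Definition spin_sign (b : pm1) : Spin7 := Spin (spin_sign_subproof b).

Lemma spin_signM : {morph spin_sign : a b / (a * b)%g}.
Proof. by move=> a b; apply/val_inj; exact: pmvalM. Qed.

Lemma spin_signC b (x : Spin7) : (spin_sign b * x = x * spin_sign b)%g.
Proof. by apply/val_inj; exact: esym (commr_sign _ _). Qed.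

Section Twist.
Variables (G : groupType) (eta : {multiplicative G -> pm1}).
Variable r : {multiplicative G -> Spin7}.
(* The morphism eta r, with {1, -1} seen in the center of Spin(7). *)
Definition twist_fun (g : G) : Spin7 := (spin_sign (eta g) * r g)%g.
Fact twistM : {morph twist_fun : x y / (x * y)%g}.
Proof.
move=> x y; rewrite /twist_fun !gmulfM spin_signM -!mulgA; congr (_ * _)%g.
by rewrite !mulgA; congr (_ * _)%g; exact: spin_signC.
Qed.
HB.instance Definition _ := isMultiplicative.Build G Spin7 twist_fun twistM.
Definition twist : {multiplicative G -> Spin7} := twist_fun.
End Twist.

Definition unacceptable (G : groupType) (r : {multiplicative G -> Spin7})
    (eta : {multiplicative G -> pm1}) :=
  (forall g, conjugate (r g) (twist eta r g)) /\ ~ hom_conjugate r (twist eta r).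

Definition acceptable (G : groupType) (r : {multiplicative G -> Spin7})
    (eta : {multiplicative G -> pm1}) := ~ unacceptable r eta.

(* psi belongs to X(r). *)
Definition inX (G : groupType) (r : {multiplicative G -> Spin7})
    (psi : {multiplicative G -> pm1}) := hom_conjugate r (twist psi r).

Section StandardModule.
Variables (G : groupType) (r : {multiplicative G -> Spin7}).
Definition std_fun (g : G) : 'M[R]_7 := spin_cover (r g).
Fact std_fun1 : std_fun 1%g = 1%:M.
Proof. by rewrite /std_fun !gmorph1. Qed.
Fact std_funM g h : std_fun (g * h)%g = std_fun g *m std_fun h.
Proof. by rewrite /std_fun !gmulfM. Qed.
Definition std_mxrepr : mxrepr R G 7 := MxRepr std_fun1 std_funM.
(* The module E = R^7. *)
Definition stdmodule : repr R G := mxmodule std_mxrepr.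
End StandardModule.

Definition type_III (G : groupType) (chi : {multiplicative G -> pm1})
    (r : {multiplicative G -> Spin7}) :=
  [/\ nontrivial chi,
      contains (stdmodule r) (charmodule R chi),
      ~ contains (stdmodule r) (charmodule R (trivial_char G))
    & exists eta' : {multiplicative G -> pm1},
        [/\ nontrivial eta', unacceptable r eta'
          & acceptable (restr_ker chi r) (restr_ker chi eta')]].

(* U is only determined up to isomorphism by E = U + chi. The submodule V0 is    *)
(* given by its matrix representation in a basis, and `contains` embeds it in   *)
(* the restriction of U to the kernel of chi.                                   *)
Definition unacceptable_IIIb (G : groupType) (chi : {multiplicative G -> pm1})
    (r : {multiplicative G -> Spin7}) (eta : {multiplicative G -> pm1}) :=
  [/\ type_III chi r, nontrivial eta, ~ inX r eta
    & exists U : repr R G, risom (stdmodule r) (rsum U (charmodule R chi)) /\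
      exists V0 : mxrepr R (ker chi) 3,
        [/\ contains (rres (val : ker chi -> G) U) (mxmodule V0),
            forall h : ker chi, \det (V0 h) = pmval R (eta (val h))
          & risom U (rind (val : ker chi -> G) (mxmodule V0))]].
End SpinSeven.

(* Coordinates: R^7 = T + T' + L, where T, T' and L are spanned by the first    *)
(* three, the next three and the last basis vectors, and F = T + T'.            *)
Section GroupI.
Variable R : realType.
Local Notation Spin7 := (spin R 7).

Definition so_mx (x : Spin7) : 'M[R]_(3 + 3 + 1) := spin_cover x.

(* The inverse image of the stabilizer of L. *)
Definition N_pred : {pred Spin7} := [pred x | ursubmx (so_mx x) == 0].

Lemma so_mxM x y : so_mx (x * y)%g = so_mx x *m so_mx y.
Proof. by rewrite /so_mx gmulfM. Qed.
Lemma so_mx1 : so_mx 1%g = 1%:M.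
Proof. by rewrite /so_mx gmorph1. Qed.
Lemma so_mxV x : so_mx x^-1%g = (so_mx x)^T.
Proof.
have e : (so_mx x)^T *m so_mx x = 1%:M.
  by apply/eqP; exact: valP (spin_cover x).
by rewrite -[RHS]mulmx1 -so_mx1 -(mulgV x) so_mxM mulmxA e mul1mx.
Qed.

Lemma N_block x : x \in N_pred ->
  exists a d, so_mx x = block_mx a 0 0 d /\ a^T *m a = 1%:M.
Proof.
rewrite inE => /eqP ur0.
have e : so_mx x *m (so_mx x)^T = 1%:M.
  by rewrite -so_mxV -so_mxM mulgV so_mx1.
move: e; rewrite -(submxK (so_mx x)) ur0.
set a := ulsubmx _; set c := dlsubmx _; set d := drsubmx _.
rewrite tr_block_mx mulmx_block trmx0 !(mul0mx, mulmx0, addr0).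
rewrite (scalar_mx_block _ _ 1) => /eq_block_mx[aa _ ca _].
have aa' : a^T *m a = 1%:M by exact: mulmx1C.
have c0 : c = 0 by rewrite -[c]mulmx1 -aa' mulmxA ca mul0mx.
by exists a, d; rewrite c0.
Qed.

Lemma N_closed : group_closed N_pred.
Proof.
split; first by rewrite inE so_mx1 (scalar_mx_block _ _ 1) block_mxKur.
move=> x y /N_block[a [d [ex _]]] /N_block[a' [d' [ey _]]].
rewrite inE so_mxM so_mxV ex ey tr_block_mx mulmx_block block_mxKur.
by rewrite !trmx0 mulmx0 mul0mx addr0.
Qed.

Record Ngroup := InN { N_val :> Spin7; _ : N_val \in N_pred }.
HB.instance Definition _ := [isSub for N_val].
HB.instance Definition _ := [Choice of Ngroup by <:].
HB.instance Definition _ :=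
  SubChoice_isSubGroup.Build Spin7 N_pred Ngroup N_closed.

(* The surjection N -> O(F). *)
Definition resF_mx (x : Ngroup) : 'M[R]_(3 + 3) := ulsubmx (so_mx x).
Fact resF_subproof x : (resF_mx x)^T *m resF_mx x == 1%:M.
Proof.
by rewrite /resF_mx; have [a [d [-> /eqP]]] := N_block (valP x); rewrite block_mxKul.
Qed.
Definition resF (x : Ngroup) : orthogonal R (3 + 3) := Orthogonal (resF_subproof x).
Fact resFM : {morph resF : x y / (x * y)%g}.
Proof.
move=> x y; apply/val_inj => /=; rewrite /resF_mx so_mxM.
have [a [d [-> _]]] := N_block (valP x); have [a' [d' [-> _]]] := N_block (valP y).
by rewrite mulmx_block !block_mxKul mul0mx addr0.
Qed.
HB.instance Definition _ :=
  isMultiplicative.Build Ngroup (orthogonal R (3 + 3)) resF resFM.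

(* The two ways for an isometry of F to preserve the pair {T, T'}: as a         *)
(* permutation of {T, T'} it has signature 1 in the first case, -1 in the       *)
(* second.                                                                      *)
Definition fixes_TT' (A : 'M[R]_(3 + 3)) := (dlsubmx A == 0) && (ursubmx A == 0).
Definition swaps_TT' (A : 'M[R]_(3 + 3)) := (ulsubmx A == 0) && (drsubmx A == 0).

Definition Ibar_pred : {pred orthogonal R (3 + 3)} := 
  [pred A : orthogonal R (3 + 3) |
    fixes_TT' A && (\det A == 1) || swaps_TT' A && (\det A == -1)].

Lemma fixes_TTP (A : 'M[R]_(3 + 3)) :
  reflect (exists a b, A = block_mx a 0 0 b) (fixes_TT' A).
Proof.
apply: (iffP andP) => [[/eqP e1 /eqP e2]|[a [b ->]]].
  by exists (ulsubmx A), (drsubmx A); rewrite -[LHS]submxK e1 e2.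
by rewrite block_mxKdl block_mxKur.
Qed.
Lemma swaps_TTP (A : 'M[R]_(3 + 3)) :
  reflect (exists a b, A = block_mx 0 a b 0) (swaps_TT' A).
Proof.
apply: (iffP andP) => [[/eqP e1 /eqP e2]|[a [b ->]]].
  by exists (ursubmx A), (dlsubmx A); rewrite -[LHS]submxK e1 e2.
by rewrite block_mxKul block_mxKdr.
Qed.

Lemma Ibar_closed : group_closed Ibar_pred.
Proof.
split.
  rewrite inE; apply/orP; left; rewrite det1 eqxx andbT.
  by apply/fixes_TTP; exists 1%:M, 1%:M; rewrite -scalar_mx_block.
move=> A B; rewrite !inE /= det_mulmx det_tr.
case/orP=> /andP[] => [/fixes_TTP|/swaps_TTP] [a [b ->]] /eqP->;
  case/orP=> /andP[] => [/fixes_TTP|/swaps_TTP] [a' [b' ->]] /eqP->;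
  rewrite tr_block_mx mulmx_block !trmx0 !(mulmx0, mul0mx, addr0, add0r);
  rewrite ?mulrNN ?mulr1 ?mul1r eqxx !andbT; apply/orP.
- by left; apply/fixes_TTP; do 2!eexists.
- by right; apply/swaps_TTP; do 2!eexists.
- by right; apply/swaps_TTP; do 2!eexists.
- by left; apply/fixes_TTP; do 2!eexists.
Qed.

Record Ibar := InIbar
  { Ibar_val :> orthogonal R (3 + 3); _ : Ibar_val \in Ibar_pred }.
HB.instance Definition _ := [isSub for Ibar_val].
HB.instance Definition _ := [Choice of Ibar by <:].
HB.instance Definition _ :=
  SubChoice_isSubGroup.Build (orthogonal R (3 + 3)) Ibar_pred Ibar Ibar_closed.

Definition alpha_bar_fun (A : Ibar) : pm1 := \det (A : 'M[R]_(3 + 3)) == -1.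

Lemma alpha_barE A : pmval R (alpha_bar_fun A) = \det (A : 'M[R]_(3 + 3)).
Proof.
rewrite /alpha_bar_fun; have N1 : (1 == -1 :> R) = false.
  by rewrite -subr_eq0 opprK -mulr2n pnatr_eq0.
by case/orP: (valP A) => /andP[_ /eqP /= ->]; rewrite ?N1 ?eqxx /pmval.
Qed.

Fact alpha_barM : {morph alpha_bar_fun : A B / (A * B)%g}.
Proof.
move=> A B; have inj : injective (@pmval R) by exact: signr_inj.
by apply: inj; rewrite pmvalM !alpha_barE /= det_mulmx.
Qed.
HB.instance Definition _ :=
  isMultiplicative.Build Ibar pm1 alpha_bar_fun alpha_barM.
Definition alpha_bar : {multiplicative Ibar -> pm1} := alpha_bar_fun.

Definition extends_detT (eps : {multiplicative Ibar -> pm1}) :=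
  forall A : Ibar, alpha_bar A = 1%g ->
    pmval R (eps A) = \det (ulsubmx (A : 'M[R]_(3 + 3))).

Definition I_pred : {pred Ngroup} := [pred x | resF x \in Ibar_pred].

Lemma I_closed : group_closed I_pred.
Proof.
split; first by rewrite inE gmorph1; case: Ibar_closed.
move=> x y; rewrite !inE => xI yI.
have e : resF y^-1%g = (resF y)^-1%g.
  by apply: (mulgI (resF y)); rewrite -gmulfM !mulgV gmorph1.
have -> : resF (x / y)%g = (resF x / resF y)%g by rewrite -e; exact: resFM.
by case: Ibar_closed => _; exact.
Qed.

Record Igroup := InI { I_val :> Ngroup; _ : I_val \in I_pred }.
HB.instance Definition _ := [isSub for I_val].
HB.instance Definition _ := [Choice of Igroup by <:].
HB.instance Definition _ :=
  SubChoice_isSubGroup.Build Ngroup I_pred Igroup I_closed.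

Definition rho : {multiplicative Igroup -> Spin7} :=
  (val : Ngroup -> Spin7) \o (val : Igroup -> Ngroup).

Definition I_to_Ibar (x : Igroup) : Ibar := InIbar (valP x).
Fact I_to_IbarM : {morph I_to_Ibar : x y / (x * y)%g}.
Proof. by move=> x y; apply/val_inj; exact: gmulfM. Qed.
HB.instance Definition _ :=
  isMultiplicative.Build Igroup Ibar I_to_Ibar I_to_IbarM.

Definition inflate (c : {multiplicative Ibar -> pm1}) :
  {multiplicative Igroup -> pm1} := c \o I_to_Ibar.
End GroupI.

(* Main.v *)
From HB Require Import structures.
Require Import Defs.
From mathcomp Require Import all_boot all_order all_algebra.
From mathcomp Require Import ring complex spectral boolp reals.
Set Implicit Arguments.
Unset Strict Implicit.
Unset Printing Implicit Defensive.
Import Order.TTheory GRing.Theory Num.Theory.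
Local Open Scope ring_scope.

(** Throughout, T, T' and L are spanned by the first three, the next three and
    the last basis vectors of R^7, F = T + T', and e_0, ..., e_6 are the basis
    vectors, which are also elements of the Clifford algebra. An element of
    Spin(7) lies in the group I exactly when the isometry that it covers either
    preserves T and T', with the same determinant on both, and fixes L, or
    exchanges T and T' and is -1 on L.

    Two elements of Spin(7) govern the pair (rho, eps). If an isometry covered
    by x preserves a coordinate subspace W, then conjugation by x multiplies the
    product of the basis vectors of W by the determinant of x on W
    ([spin_conj_clprod]; by Cartan-Dieudonne this is a statement about
    reflections in vectors of W). For W = F it says that the product of
    e_0, ..., e_5 conjugates every x in I to alpha(x) x ([conj_alpha]). For
    W = T + L it says that one and the same element conjugates every x in the
    kernel of alpha to eps(x) x ([conj_eps]). Hence x and eps(x) x are always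
    conjugate, and on the kernel of alpha they are so uniformly. They are not
    uniformly conjugate on I ([rho_not_conj]): a conjugating element k would
    cover an isometry that commutes with those covered by I, among which are the
    changes of sign of any two coordinates of F and the exchange of T and T'. So
    that isometry would multiply e_0 and e_3 by a common sign, and k would
    commute with e_0 e_3; but e_0 e_3 is in I and eps takes the value -1 there.
    Finally F is induced from T: v goes to the function x |-> p_T(x v), with p_T
    the projection to T ([F_induced]).

    Conversely, let (r, eta) be of type IIIb and let g be outside of the kernel
    Gam0 of chi. The isomorphism from U to the module induced from V0, followed
    by evaluation at 1, is a Gam0-morphism A from R^7 to V0. The maps A and A g
    and the coordinate on which Gam acts by chi are together a system of
    coordinates of R^7 in which every r(x) has the block shape that defines I
    ([IIIb_coordinates]). These coordinates need not be orthogonal. But V0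
    embeds in R^7, so it carries an invariant inner product
    ([orthogonalizable]); for it the block matrices are orthogonal, and
    equivalent orthogonal representations are orthogonally equivalent by polar
    decomposition ([orthogonal_equiv]). Both facts rest on a square root of a
    Gram matrix that commutes with whatever commutes with that matrix
    ([gram_sqrt]). So the coordinates can be made orthogonal
    ([IIIb_orthogonal_coordinates]), and they lift to Spin(7) once they have
    determinant 1 ([spin_cover_surj]). At this point eta and eps o f agree on
    Gam0, so they agree everywhere if they agree at g. Multiplying the
    coordinates of T' by -1 exchanges eps and alpha eps, and that is the freedom
    which makes them agree at g ([factor_through_I]). *)

(** * Square roots of Gram matrices *)

Lemma interpolation (F : fieldType) (f : F -> F) (s : seq F) :
  exists p : {poly F}, forall a, a \in s -> p.[a] = f a.
Proof.
elim: s => [|b s [p Hp]]; first by exists 0.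
have [bs|bs] := boolP (b \in s).
  by exists p => a; rewrite inE => /orP[/eqP->|]; apply: Hp.
pose q := \prod_(c <- s) ('X - c%:P).
have qb : q.[b] != 0.
  by rewrite -[_ == 0]/(root q b) root_prod_XsubC.
exists (p + ((f b - p.[b]) / q.[b])%:P * q) => a.
rewrite inE hornerD hornerM hornerC => /orP[/eqP->|sa].
  by rewrite divfK // addrC subrK.
have /eqP -> : q.[a] == 0 by rewrite -[_ == 0]/(root q a) root_prod_XsubC.
by rewrite mulr0 addr0 Hp.
Qed.

Lemma trmx_horner (R : comNzRingType) n (A : 'M[R]_n.+1) (p : {poly R}) :
  (horner_mx A p)^T = horner_mx A^T p.
Proof.
elim/poly_ind: p => [|p c IH]; first by rewrite !rmorph0 trmx0.
rewrite !rmorphD !rmorphM /= !horner_mx_X !horner_mx_C linearD /= tr_scalar_mx.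
rewrite trmx_mul IH; congr (_ + _).
exact: comm_mx_horner.
Qed.

Lemma horner_mx_similar (F : fieldType) n (P D : 'M[F]_n.+1) (p : {poly F}) :
  P \in unitmx ->
  horner_mx (invmx P *m D *m P) p = invmx P *m horner_mx D p *m P.
Proof.
move=> Pu; elim/poly_ind: p => [|p c IH].
  by rewrite !rmorph0 mulmx0 mul0mx.
rewrite !rmorphD !rmorphM /= !horner_mx_X !horner_mx_C IH.
rewrite mulmxDr mulmxDl; congr (_ + _); last first.
  by rewrite mul_mx_scalar -scalemxAl mulVmx // scalemx1.
by rewrite -[LHS]/(_ *m _) -[X in _ = _ *m X *m _]/(_ *m _) !mulmxA mulmxK.
Qed.

(** A Gram matrix is diagonalizable over the complex numbers with nonnegative
    eigenvalues, so any real polynomial that interpolates the square root at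
    these eigenvalues sends the matrix to a square root of it. Asking for a
    polynomial keeps the root real and makes it commute with whatever commutes
    with the matrix. *)
Lemma gram_sqrt_poly (R : rcfType) m n (X : 'M[R]_(m, n.+1)) :
  exists p : {poly R}, let B := horner_mx (X^T *m X) p in B *m B = X^T *m X.
Proof.
(* The spectral theorem is available over a closed field: pass to R[i]. *)
pose C := R[i]%C.
pose toC : {rmorphism R -> C} := real_complex R.
have toC_conj k l (A : 'M[R]_(k, l)) : map_mx Num.conj (map_mx toC A) = map_mx toC A.
  by apply/matrixP=> i j; rewrite !mxE; exact: conjc_real.
set S := X^T *m X; pose SC := map_mx toC S; pose XC := map_mx toC X.
have SE : SC = XC^T *m XC by rewrite /SC map_mxM map_trmx.
have Sh : SC \is hermsymmx.
  apply/is_hermitianmxP; rewrite expr0 scale1r SE.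
  by rewrite trmx_mul trmxK map_mxM -map_trmx toC_conj.
have Sn := hermitian_normalmx Sh.
set P := spectralmx SC; set d := spectral_diag SC.
have SD : SC = invmx P *m diag_mx d *m P by exact/orthomx_spectralP.
have Pu : P \in unitmx by exact: spectral_unit.
have PV : invmx P = map_mx Num.conj P^T.
  by rewrite invmx_unitary ?spectral_unitarymx.
(* The eigenvalues are the squared norms of the columns of X P^-1. *)
have d_ge0 i : 0 <= d 0 i.
  have E : diag_mx d = (map_mx Num.conj (XC *m invmx P)^T) *m (XC *m invmx P).
    have PT : (map_mx Num.conj (invmx P))^T = P.
      rewrite PV -(map_mx_comp Num.conj) (map_mx_id (@Num.Theory.conjCK _)).
      exact: trmxK.
    rewrite trmx_mul map_mxM -!map_trmx toC_conj PT.
    by rewrite -!mulmxA [XC^T *m _]mulmxA -SE SD !mulmxA mulmxV // mul1mx mulmxK.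
  have := congr1 (fun M : 'M_n.+1 => M i i) E; rewrite !mxE eqxx mulr1n => ->.
  by apply: sumr_ge0 => k _; rewrite !mxE -normCKC exprn_ge0.
have [p pE] := interpolation (fun x => Num.sqrt x) [seq complex.Re (d 0 i) | i : 'I_n.+1].
exists p => /=; apply: (map_mx_inj (f := toC)) => //.
rewrite map_mxM map_horner_mx -/SC {1 2}SD !horner_mx_similar //.
rewrite SD -!mulmxA mulKVmx // !mulmxA; congr (_ *m _).
rewrite -!mulmxA; congr (_ *m _); rewrite horner_mx_diag mulmx_diag.
congr diag_mx; apply/rowP=> i; rewrite !mxE.
have dR : d 0 i = toC (complex.Re (d 0 i)) by rewrite [RHS]RRe_real ?ger0_real.
have ps : (map_poly toC p).[d 0 i] = toC (Num.sqrt (complex.Re (d 0 i))).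
  by rewrite {1}dR horner_map pE // image_f.
rewrite ps -rmorphM -expr2 sqr_sqrtr -?dR //.
by rewrite -ler0c -[_%:C%C]dR.
Qed.

(** * Cartan-Dieudonne and products of basis vectors in the Clifford algebra *)

Section CartanDieudonne.
Variables (R : realType) (n : nat).
Local Notation Cl := (clifford R n).
Local Notation e i := (delta_mx i 0 : 'cV[R]_n).
Implicit Types (u v w : 'cV[R]_n) (s : seq 'cV[R]_n) (A : 'M[R]_n).

(** The reflection in the hyperplane orthogonal to u: vecflip u, which comes
    from conjugation by u, is its opposite. *)
Definition reflmx u : 'M[R]_n := - vecflip u.
Definition reflprod s : 'M[R]_n := foldr (fun u M => reflmx u *m M) 1%:M s.

Lemma reflmxE u v : reflmx u *m v = v - (dotp u v *+ 2) *: u.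
Proof.
rewrite /reflmx /vecflip opprB mulmxBl mul1mx -scalemxAl -mulmxA.
have -> : u^T *m v = (dotp u v)%:M.
  by rewrite dotpE; apply/matrixP=> i j; rewrite !ord1 [RHS]mxE eqxx mulr1n.
by rewrite mul_mx_scalar scalerA mulr_natl.
Qed.

Lemma reflmx_ortho u : unitvec u -> (reflmx u)^T *m reflmx u = 1%:M.
Proof.
by move=> u1; rewrite /reflmx mulmxN [(- _)^T]linearN mulNmx opprK vecflip_ortho.
Qed.

Lemma reflmx_invol u : unitvec u -> reflmx u *m reflmx u = 1%:M.
Proof.
move=> u1; rewrite -[X in X *m _]trmxK (_ : (reflmx u)^T = reflmx u).
  exact: reflmx_ortho.
by rewrite /reflmx /vecflip linearN linearB linearZ /= trmx_mul trmxK trmx1.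
Qed.

Lemma det_reflmx u : unitvec u -> \det (reflmx u) = -1.
Proof.
move=> u1; rewrite /reflmx -scaleN1r detZ det_vecflip //.
by rewrite mulrN -exprD addnn -signr_odd odd_double.
Qed.

Lemma det_reflprod s : all (@unitvec R n) s ->
  \det (reflprod s) = (-1) ^+ size s.
Proof.
elim: s => [_|u s IH /= /andP[u1 us]]; first by rewrite det1.
by rewrite det_mulmx IH // det_reflmx // exprS.
Qed.

Lemma dotp_delta v i : dotp v (e i) = v i 0.
Proof.
rewrite /dotp (bigD1 i) //= big1 => [|j /negPf ji]; rewrite !mxE ?eqxx ?mulr1 ?addr0 //.
by rewrite ji mulr0.
Qed.

Lemma dotpC u v : dotp u v = dotp v u.
Proof. by apply: eq_bigr => i _; rewrite mulrC. Qed.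

Lemma dotp_ortho A u v : A^T *m A = 1%:M -> dotp (A *m u) (A *m v) = dotp u v.
Proof. by move=> A1; rewrite !dotpE trmx_mul mulmxA -[_ *m A]mulmxA A1 mulmx1. Qed.

Lemma dotpDl u v w : dotp (u + v) w = dotp u w + dotp v w.
Proof. by rewrite !dotpE linearD mulmxDl mxE. Qed.
Lemma dotpZl a u v : dotp (a *: u) v = a * dotp u v.
Proof. by rewrite !dotpE linearZ -scalemxAl mxE. Qed.
Lemma dotpBl u v w : dotp (u - v) w = dotp u w - dotp v w.
Proof. by rewrite dotpDl -scaleN1r dotpZl mulN1r. Qed.

Lemma dotp_ge0 v : 0 <= dotp v v.
Proof. by apply: sumr_ge0 => i _; rewrite -expr2 sqr_ge0. Qed.

Lemma dotp_eq0 v : (dotp v v == 0) = (v == 0).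
Proof.
apply/eqP/eqP=> [v0|->]; last first.
  by rewrite /dotp big1 // => i _; rewrite mxE mul0r.
apply/colP=> i; rewrite mxE; apply/eqP; rewrite -sqrf_eq0 expr2.
have /psumr_eq0P -> // : \sum_j v j 0 * v j 0 = 0 by [].
by move=> j _; rewrite -expr2 sqr_ge0.
Qed.

Definition supported (D : {pred 'I_n}) u := [forall j, (j \notin D) ==> (u j 0 == 0)].

Lemma supportedP (D : {pred 'I_n}) u :
  reflect (forall j, j \notin D -> u j 0 = 0) (supported D u).
Proof.
apply: (iffP forallP) => H j; last by apply/implyP=> /H ->.
by move=> jD; have /implyP/(_ jD)/eqP := H j.
Qed.

Lemma sub_supported (D D' : {pred 'I_n}) u :
  {subset D <= D'} -> supported D u -> supported D' u.
Proof.
move=> DD' /supportedP H; apply/supportedP=> j jD'; apply: H.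
by apply: contra jD' => /DD'.
Qed.

(** Reflecting in the direction of A e_i - e_i brings A e_i back to e_i, and
    that direction is supported in D when A fixes the basis vectors outside of
    D. Keeping track of the support is what allows the theorem to be used inside
    a coordinate subspace, without a change of dimension. *)
Lemma cartan_dieudonne (D : {set 'I_n}) A :
  A^T *m A = 1%:M -> (forall j, j \notin D -> A *m e j = e j) ->
  exists s, [/\ all (@unitvec R n) s, all (supported (mem D)) s & A = reflprod s].
Proof.
have [m] := ubnP #|D|; elim: m => // m IH in D A *; rewrite ltnS => Dm A1 AD.
have [D0|[i iD]] := set_0Vmem D.
  exists [::]; split=> //; apply/matrixP=> i j.
  have := congr1 (fun v : 'cV_n => v i 0) (AD j _).
  rewrite D0 inE /= -colE mxE => -> //; by rewrite !mxE eqxx andbT.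
have Di : (#|D :\ i| < m)%N by rewrite (cardsD1 i D) iD in Dm.
have subD : {subset mem (D :\ i) <= mem D} by move=> j; rewrite /= !inE => /andP[].
have sub s : all (supported (mem (D :\ i))) s -> all (supported (mem D)) s.
  by apply: sub_all => v; exact: sub_supported.
pose w := A *m e i.
have ww : dotp w w = 1 by rewrite dotp_ortho // dotp_delta mxE !eqxx.
have ee : dotp (e i) (e i) = 1 by rewrite dotp_delta mxE !eqxx.
have [we|we] := eqVneq w (e i).
  have [|s [s1 s2 s3]] := IH _ A Di A1.
    move=> j; rewrite !inE negb_and negbK => /orP[/eqP-> //|]; exact: AD.
  by exists s; split=> //; apply: sub.
pose z := w - e i; pose N := dotp z z.
have N0 : N != 0 by rewrite dotp_eq0 subr_eq0.
have Ngt : 0 < N by rewrite lt_def N0 dotp_ge0.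
have zw : dotp z w *+ 2 = N.
  rewrite /N {2}/z dotpC [X in _ = X]dotpC -/z [dotp z (_ - _)]dotpC dotpBl.
  rewrite /z ![dotp _ (w - _)]dotpC !dotpBl ww ee [dotp (e i) w]dotpC; ring.
pose u := (Num.sqrt N)^-1 *: z.
have uu v : (dotp u v *+ 2) *: u = (dotp z v *+ 2 / N) *: z.
  rewrite /u dotpZl scalerA; congr (_ *: _).
  rewrite -mulrnAr mulrAC -invfM -expr2 sqr_sqrtr ?ltW // mulrC //.
have u1 : unitvec u.
  rewrite /unitvec /u dotpZl dotpC dotpZl mulrA -invfM -expr2 sqr_sqrtr ?ltW //.
  by rewrite mulVf.
have zD j : j \notin D -> z j 0 = 0.
  move=> jD; have := dotp_ortho (e i) (e j) A1; rewrite (AD j jD) !dotp_delta => wj.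
  by rewrite mxE wj [X in _ + X]mxE subrr.
have fixj j : j \notin D -> reflmx u *m e j = e j.
  by move=> jD; rewrite reflmxE uu dotp_delta zD // mul0rn mul0r scale0r subr0.
have fixi : reflmx u *m w = e i.
  by rewrite reflmxE uu zw divff // scale1r /z opprB addrC subrK.
have [||s [s1 s2 s3]] := IH _ (reflmx u *m A) Di.
- by rewrite trmx_mul mulmxA -[_ *m reflmx u]mulmxA reflmx_ortho // mulmx1.
- move=> j; rewrite !inE negb_and negbK => /orP[/eqP->|jD].
    by rewrite -mulmxA.
  by rewrite -mulmxA (AD j jD) fixj.
exists (u :: s); split=> /=; first by rewrite u1.
  rewrite sub // andbT; apply/supportedP=> j jD.
  by rewrite mxE zD ?mulr0.
by rewrite -/(reflprod s) -s3 mulmxA reflmx_invol // mul1mx.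
Qed.

Lemma clvec_reflmx u v : unitvec u ->
  clvec (reflmx u *m v) = - (clvec u * clvec v * clvec u) :> Cl.
Proof. by move=> u1; rewrite /reflmx mulNmx linearN /= clvec_flip. Qed.

Lemma clvec_unit_sqr u : unitvec u -> clvec u * clvec u = 1 :> Cl.
Proof. by move=> /eqP u1; rewrite clvec_sqr u1 scale1r. Qed.

Lemma spin_cover_prod (x : spin R n) s : all (@unitvec R n) s ->
  (x : Cl) = \prod_(v <- s) clvec v ->
  spin_cover_mx x = (-1) ^+ size s *: reflprod s.
Proof.
move=> s1 xE; apply: spin_cover_uniq => v; rewrite xE spin_inv_subproof //.
elim: s s1 {x xE} => [_|u s IH /= /andP[u1 us]].
  by rewrite !big_nil mulr1 mul1r scale1r mul1mx.
rewrite rev_cons big_cons big_rcons /= !mulrA -[_ * clvec v]mulrA.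
rewrite -[_ * (_ * clvec v) * _]mulrA IH // exprS mulN1r scaleNr mulNmx.
rewrite -!scalemxAl -mulmxA linearN !linearZ /= clvec_reflmx //.
by rewrite opprK -scalerAr -scalerAl.
Qed.

(** A rotation is a product of an even number of reflections, and each
    reflection is, up to sign, conjugation by a unit vector; an even number of
    signs cancels. *)
Lemma spin_cover_surj A : A^T *m A = 1%:M -> \det A = 1 ->
  exists x : spin R n, spin_cover_mx x = A.
Proof.
move=> A1 dA; have [|s [s1 _ sA]] := @cartan_dieudonne setT A A1.
  by move=> j; rewrite inE.
have os : ~~ odd (size s).
  apply/negP=> os; move: dA; rewrite sA det_reflprod // -signr_odd os.
  by move=> /eqP; rewrite expr1 -subr_eq0 -opprD oppr_eq0 -mulr2n pnatr_eq0.
have xs : \prod_(v <- s) clvec v \in @spin_pred R n by apply/asboolP; exists s.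
exists (Spin xs); rewrite (spin_cover_prod s1) //.
by rewrite -signr_odd (negPf os) scale1r.
Qed.

Definition clprod (t : seq 'I_n) : Cl := \prod_(i <- t) cle R [set i].

Lemma cle_swap i j : i != j ->
  cle R [set i] * cle R [set j] = - (cle R [set j] * cle R [set i]) :> Cl.
Proof.
move=> /negPf ij; apply/eqP; rewrite -addr_eq0 cle_anticomm ij.
by rewrite mul0rn scale0r.
Qed.

(** Moving e_i through the product costs one sign for each factor different
    from e_i; [clprod_in] has one sign less because e_i is itself a factor. *)
Lemma clprod_notin i t : i \notin t ->
  cle R [set i] * clprod t = (-1) ^+ size t * (clprod t * cle R [set i]).
Proof.
rewrite /clprod; elim: t => [_|j t IH]; first by rewrite big_nil !mul1r mulr1.
rewrite inE negb_or big_cons => /andP[ij it] /=.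
rewrite mulrA cle_swap // mulNr -[X in - X]mulrA IH // exprS -!mulrA mulN1r; congr (- _).
by rewrite !mulrA commr_sign.
Qed.

Lemma clprod_in i t : i \in t -> uniq t ->
  cle R [set i] * clprod t = - (-1) ^+ size t * (clprod t * cle R [set i]).
Proof.
rewrite /clprod; elim: t => // j t IH; rewrite inE big_cons /= exprS mulN1r opprK.
have [<- _ /andP[it _]|ij /= it /andP[_ ut]] := eqVneq i j.
  have := clprod_notin it; rewrite /clprod => /(congr1 (fun x => (-1) ^+ size t * x)).
  rewrite signrMK => E; rewrite -[X in _ = _ * X]mulrA -E.
  by rewrite [X in _ = _ * X]mulrA commr_sign -!mulrA signrMK.
rewrite mulrA cle_swap // mulNr -[X in - X]mulrA IH // !mulNr mulrN opprK.
by rewrite !mulrA commr_sign.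
Qed.

Lemma clvec_clprod u t : supported (mem t) u -> uniq t ->
  clvec u * clprod t = - (-1) ^+ size t * (clprod t * clvec u).
Proof.
move=> /supportedP su ut; rewrite /clvec mulr_suml !mulr_sumr.
apply: eq_bigr => i _; have [it|it] := boolP (i \in t); last first.
  by rewrite su // !scale0r mul0r !mulr0.
by rewrite -scalerAl -!scalerAr clprod_in.
Qed.

(** An isometry of the span of the e_i, i in t, multiplies their product by its
    determinant, which is (-1) ^+ size s for a product of the reflections s.
    A single reflection, w |-> - u w u, turns the product E into
    (-1) ^+ size t * (u E u), and u anticommutes or commutes with E so that this
    is - E. *)
Lemma clprod_reflprod s (t : seq 'I_n) : all (@unitvec R n) s -> all (supported (mem t)) s ->
  uniq t ->
  \prod_(i <- t) clvec (reflprod s *m e i) = (-1) ^+ size s * clprod t.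
Proof.
move=> s1 st ut; elim: s s1 st => [_ _|u s IH /= /andP[u1 us] /andP[ut' st]].
  rewrite mul1r; apply: eq_bigr => i _; by rewrite mul1mx clvec_delta.
have conj (r : seq 'I_n) (f : 'I_n -> Cl) :
    \prod_(i <- r) - (clvec u * f i * clvec u)
    = (-1) ^+ size r * (clvec u * (\prod_(i <- r) f i) * clvec u).
  elim: r => [|i r IHr]; first by rewrite !big_nil !mul1r mulr1 clvec_unit_sqr.
  rewrite !big_cons IHr /= exprS !mulN1r !mulNr; congr (- _).
  rewrite [LHS]mulrA [X in X * _ = _]commr_sign -!mulrA; congr (_ * (_ * (_ * _))).
  by rewrite !mulrA clvec_unit_sqr // mul1r.
under eq_bigr => i _ do rewrite -/(reflprod s) -mulmxA clvec_reflmx //.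
rewrite conj IH // exprS mulN1r.
rewrite [clvec u * (_ * _)]mulrA commr_sign -[_ * clvec u * clprod t]mulrA.
rewrite clvec_clprod // -!mulrA clvec_unit_sqr // mulr1 !mulNr !mulrN.
congr (- _); rewrite [_ ^+ size s * _]mulrA.
by rewrite [_ ^+ size s * _ ^+ size t]commr_sign -!mulrA signrMK.
Qed.

(** A is the isometry covered by x on the span of the e_i, i in t, and the
    identity on the other basis vectors, so that its determinant is that of x on
    a coordinate subspace. *)
Lemma spin_conj_clprod (x : spin R n) A (t : seq 'I_n) : uniq t ->
  A^T *m A = 1%:M ->
  (forall i, i \in t -> A *m e i = spin_cover_mx x *m e i) ->
  (forall j, j \notin t -> A *m e j = e j) ->
  (x : Cl) * clprod t = \det A *: clprod t * (x : Cl).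
Proof.
move=> ut A1 At AnT; have [|s [s1 st sA]] := @cartan_dieudonne [set i in t] A A1.
  by move=> j; rewrite inE; exact: AnT.
have st' : all (supported (mem t)) s.
  by apply: sub_all st => v; apply: sub_supported => j; rewrite /= inE.
have xU : (x : Cl) \is a GRing.unit by exact: spin_unit (valP x).
have conj (r : seq 'I_n) (f : 'I_n -> Cl) :
    (x : Cl) * (\prod_(i <- r) f i) * (x : Cl)^-1
    = \prod_(i <- r) ((x : Cl) * f i * (x : Cl)^-1).
  elim: r => [|i r IHr]; first by rewrite !big_nil mulr1 divrr.
  by rewrite !big_cons -IHr !mulrA mulrVK.
rewrite -[LHS](mulrVK xU); congr (_ * _); rewrite conj.
transitivity (\prod_(i <- t) clvec (A *m e i) : Cl).
  rewrite !big_seq; apply: eq_bigr => i it.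
  by rewrite -clvec_delta spin_coverP At.
rewrite {1}sA clprod_reflprod // sA det_reflprod //.
rewrite -[in LHS]signr_odd -[in RHS]signr_odd.
by case: (odd _); rewrite ?expr0 ?scale1r ?mul1r // !expr1 mulN1r scaleN1r.
Qed.
End CartanDieudonne.

(** * Orthogonal representations *)

Definition is_ortho (R : realType) n (G : 'M[R]_n) := G^T *m G = 1%:M.

Lemma inj_unitmx (F : fieldType) n (X : 'M[F]_n) :
  (forall v : 'cV_n, X *m v = 0 -> v = 0) -> X \in unitmx.
Proof.
move=> inj; rewrite -unitmx_tr -row_free_unit -kermx_eq0.
apply/eqP/row_matrixP => i; rewrite row0; apply: trmx_inj; rewrite trmx0.
apply: inj; rewrite -[X in X *m _]trmxK -trmx_mul; apply/eqP; rewrite trmx_eq0.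
by rewrite -row_mul mulmx_ker row0.
Qed.

Lemma gram_unitmx (R : realType) m n (X : 'M[R]_(m, n)) :
  (forall v : 'cV_n, X *m v = 0 -> v = 0) -> X^T *m X \in unitmx.
Proof.
move=> inj; apply: inj_unitmx => v XXv; apply: inj; apply/colP=> i; rewrite [RHS]mxE.
have /psumr_eq0P E : \sum_i (X *m v) i 0 ^+ 2 = 0.
  have : (v^T *m (X^T *m X *m v)) 0 0 = 0 by rewrite XXv mulmx0 mxE.
  rewrite !mulmxA -trmx_mul -mulmxA mxE => E0; rewrite -[RHS]E0.
  by apply: eq_bigr => j _; rewrite [_^T 0 j]mxE.
apply/eqP; rewrite -sqrf_eq0; apply/eqP/E => // j _; exact: sqr_ge0.
Qed.

Lemma gram_sqrt (R : realType) m n (X : 'M[R]_(m, n.+1)) :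
  (forall v : 'cV_n.+1, X *m v = 0 -> v = 0) ->
  exists B, [/\ B^T = B, B \in unitmx, B *m B = X^T *m X
    & forall G, comm_mx G (X^T *m X) -> comm_mx G B].
Proof.
move=> /gram_unitmx XXu; have [p /= pE] := gram_sqrt_poly X.
exists (horner_mx (X^T *m X) p); split=> //.
- by rewrite trmx_horner trmx_mul trmxK.
- set B := horner_mx _ _ in pE *.
  have : B *m B \in unitmx by rewrite pE.
  by rewrite unitmx_mul => /andP[].
- by move=> G; exact: comm_mx_horner.
Qed.

(** The columns of X embed a representation V in orthogonal ones: the inner
    product X^T X of the ambient space is then invariant under V, and the square
    root C of X^T X makes it the standard one. *)
Lemma orthogonalizable (R : realType) m n (X : 'M[R]_(m, n.+1)) :
  (forall v : 'cV_n.+1, X *m v = 0 -> v = 0) ->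
  exists2 C, C \in unitmx & forall G V, is_ortho G -> X *m V = G *m X ->
    is_ortho (C *m V *m invmx C).
Proof.
move=> /gram_sqrt[C [Ct Cu CC _]]; exists C => // G V G1 XV.
rewrite /is_ortho !trmx_mul trmx_inv Ct.
rewrite -!mulmxA [C *m (C *m _)]mulmxA CC.
rewrite [X in V^T *m X]mulmxA -[X^T *m X *m V]mulmxA XV mulmxA.
rewrite !mulmxA -[_ *m V^T *m _]mulmxA -trmx_mul XV trmx_mul mulmxA.
by rewrite -[_ *m G^T *m _]mulmxA G1 mulmx1 -[_ *m X^T *m X]mulmxA -CC mulKmx // mulmxV.
Qed.

(** Q is the orthogonal factor of the polar decomposition of X: the matrix
    X^T X, hence its square root, commutes with the representation G. *)
Lemma orthogonal_equiv (R : realType) n (X : 'M[R]_n.+1) : X \in unitmx ->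
  exists2 Q, is_ortho Q & forall E G, is_ortho E -> is_ortho G ->
    X *m G = E *m X -> Q *m G = E *m Q.
Proof.
move=> Xu; have [|B [Bt Bu BB Bc]] := @gram_sqrt _ _ _ X.
  by move=> v /(congr1 (mulmx (invmx X))); rewrite mulKmx // mulmx0.
exists (X *m invmx B).
  rewrite /is_ortho trmx_mul trmx_inv Bt -mulmxA [X^T *m (_ *m _)]mulmxA -BB.
  by rewrite mulmxK // mulVmx.
move=> E G E1 G1 XG.
have GS : comm_mx G (X^T *m X).
  have G1' : G *m G^T = 1%:M by exact: mulmx1C.
  have GSG : G^T *m (X^T *m X) *m G = X^T *m X.
    rewrite mulmxA -mulmxA XG -trmx_mul XG trmx_mul -!mulmxA [E^T *m _]mulmxA E1.
    by rewrite mul1mx.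
  by rewrite /comm_mx -{1}GSG !mulmxA G1' mul1mx.
have GB : comm_mx G (invmx B).
  rewrite /comm_mx -[LHS]mul1mx -(mulVmx Bu) -!mulmxA [B *m _]mulmxA -Bc //.
  by rewrite mulmxK.
by rewrite -mulmxA -GB mulmxA XG mulmxA.
Qed.

(** * The group I in terms of matrices *)

Section GroupI.
Variable R : realType.
Local Notation Spin7 := (spin R 7).
Local Notation Cl := (clifford R 7).
Implicit Types (x : Spin7) (A : Ibar R).

(** The only rotation of R^7 that preserves L and restricts to the isometry a of
    F. *)
Definition extF (a : 'M[R]_(3 + 3)) : 'M[R]_(3 + 3 + 1) :=
  block_mx a 0 0 (\det a)%:M.

Lemma so_mx_ortho x : is_ortho (so_mx x).
Proof. exact/eqP/(valP (spin_cover x)). Qed.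

Lemma det_so_mx x : \det (so_mx x) = 1.
Proof. exact: det_spin_cover. Qed.

Lemma ortho_det n (a : 'M[R]_n) : is_ortho a -> \det a * \det a = 1.
Proof. by move=> a1; rewrite -{1}det_tr -det_mulmx a1 det1. Qed.

Lemma extF_ortho a : is_ortho a -> is_ortho (extF a).
Proof.
move=> a1; rewrite /is_ortho tr_block_mx mulmx_block !trmx0 tr_scalar_mx a1.
rewrite !(mul0mx, mulmx0, addr0, add0r) -scalar_mxM ortho_det //.
by rewrite [RHS](scalar_mx_block _ _ 1).
Qed.

Lemma det_extF a : is_ortho a -> \det (extF a) = 1.
Proof. by move=> a1; rewrite det_ublock det_scalar1 ortho_det. Qed.

(** The entry on L is forced by the determinant being 1. *)
Lemma so_mx_N (y : Ngroup R) : so_mx y = extF (resF_mx y).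
Proof.
have [a [d [yE a1]]] := N_block (valP y).
rewrite /resF_mx yE block_mxKul /extF; congr block_mx.
have : \det (so_mx y) = 1 by exact: det_so_mx.
rewrite yE det_ublock [d]mx11_scalar det_scalar1 => ad.
by rewrite -[d 0 0]mul1r -(ortho_det a1) -mulrA ad mulr1.
Qed.

Lemma Ibar_ortho A : is_ortho (A : 'M[R]_(3 + 3)).
Proof. exact/eqP/(valP (val A)). Qed.

Lemma extF_inN x a : so_mx x = extF a -> x \in @N_pred R.
Proof. by move=> xa; rewrite inE xa block_mxKur. Qed.

Lemma inI_ex x A : so_mx x = extF A -> exists2 y : Igroup R, rho R y = x & I_to_Ibar y = A.
Proof.
move=> xA; have xN := extF_inN xA.
have rA : resF (InN xN) = val A.
  by apply/val_inj; rewrite /= /resF_mx xA block_mxKul.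
have xI : InN xN \in @I_pred R by rewrite inE rA; exact: (valP A).
by exists (InI xI) => //; apply/val_inj.
Qed.

Lemma I_lift A : exists y : Igroup R, I_to_Ibar y = A.
Proof.
have A1 := Ibar_ortho A.
have [x xA] := spin_cover_surj (extF_ortho A1) (det_extF A1).
by have [y _ yA] := inI_ex (xA : so_mx x = extF A); exists y.
Qed.

Lemma so_mx_rho (y : Igroup R) : so_mx (rho R y) = extF (I_to_Ibar y).
Proof. exact: so_mx_N. Qed.

Lemma inIbar_fix (a b : 'M[R]_3) : is_ortho a -> is_ortho b -> \det a = \det b ->
  exists A : Ibar R, (A : 'M[R]_(3 + 3)) = block_mx a 0 0 b.
Proof.
move=> a1 b1 ab.
have o : (block_mx a 0 0 b)^T *m block_mx a 0 0 b == 1%:M.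
  rewrite tr_block_mx mulmx_block !trmx0 !(mul0mx, mulmx0, addr0, add0r) a1 b1.
  by rewrite -scalar_mx_block.
have I : Orthogonal o \in @Ibar_pred R.
  rewrite inE /=; apply/orP; left; rewrite det_ublock ab ortho_det // eqxx andbT.
  by apply/fixes_TTP; exists a, b.
by exists (InIbar I).
Qed.

Lemma det_swap_block (a b : 'M[R]_3) : \det (block_mx 0 a b 0) = - (\det a * \det b).
Proof.
(* J adds columns so as to make the matrix block triangular. *)
pose J : 'M[R]_(3 + 3) := block_mx 1%:M 1%:M (- 1%:M) 0.
have dJ : \det J = 1.
  have -> : J = block_mx 1%:M 0 (- 1%:M) 1%:M *m block_mx 1%:M 1%:M 0 1%:M.
    rewrite mulmx_block !(mul1mx, mulmx1, mulmx0, mul0mx, addr0, add0r).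
    by rewrite addNr.
  by rewrite det_mulmx det_lblock det_ublock !det1 !mulr1.
have : \det (block_mx 0 a b 0 *m J) = - (\det a * \det b).
  rewrite mulmx_block !(mul1mx, mulmx1, mulmx0, mul0mx, addr0, add0r).
  rewrite mulmxN mulmx1.
  have -> : block_mx (- a) 0 b b = block_mx (- a) 0 0 1%:M *m block_mx 1%:M 0 b b.
    by rewrite mulmx_block !(mul1mx, mulmx1, mulmx0, mul0mx, addr0, add0r).
  rewrite det_mulmx !det_lblock !det1 mulr1 mul1r -scaleN1r detZ.
  by rewrite -signr_odd /= expr1 mulN1r mulNr.
by rewrite det_mulmx dJ mulr1.
Qed.

Lemma inIbar_swap (a b : 'M[R]_3) : is_ortho a -> is_ortho b -> \det a = \det b ->
  exists A : Ibar R, (A : 'M[R]_(3 + 3)) = block_mx 0 a b 0.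
Proof.
move=> a1 b1 ab.
have o : (block_mx 0 a b 0)^T *m block_mx 0 a b 0 == 1%:M.
  rewrite tr_block_mx mulmx_block !trmx0 !(mul0mx, mulmx0, addr0, add0r) a1 b1.
  by rewrite -scalar_mx_block.
have I : Orthogonal o \in @Ibar_pred R.
  rewrite inE /=; apply/orP; right.
  rewrite det_swap_block ab ortho_det // eqxx andbT.
  by apply/swaps_TTP; exists a, b.
by exists (InIbar I).
Qed.

Lemma pmval_inj : injective (@pmval R). Proof. exact: signr_inj. Qed.
Lemma pmval1 : pmval R 1%g = 1. Proof. by []. Qed.
Lemma pmvalN1 (b : pm1) : b <> 1%g -> pmval R b = -1.
Proof. by case: b => // _; rewrite /pmval expr1. Qed.

Lemma alpha_det A : pmval R (alpha_bar R A) = \det (A : 'M[R]_(3 + 3)).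
Proof. exact: alpha_barE. Qed.

Lemma oneN1 : (1 == -1 :> R) = false.
Proof. by rewrite -subr_eq0 opprK -mulr2n pnatr_eq0. Qed.

Lemma Ibar_fixP A : alpha_bar R A = 1%g -> exists a b : 'M[R]_3,
  [/\ (A : 'M[R]_(3 + 3)) = block_mx a 0 0 b, is_ortho a, is_ortho b & \det a = \det b].
Proof.
move=> A1; have dA : \det (A : 'M[R]_(3 + 3)) = 1 by rewrite -alpha_det A1.
have := valP A; rewrite inE /= dA eqxx oneN1 andbF orbF andbT.
case/fixes_TTP=> a [b AE]; exists a, b; have := Ibar_ortho A.
rewrite /is_ortho AE tr_block_mx mulmx_block !trmx0 !(mul0mx, mulmx0, addr0, add0r).
rewrite scalar_mx_block => /eq_block_mx[a1 _ _ b1]; split=> //.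
move: dA; rewrite AE det_ublock => ab.
by rewrite -[LHS]mulr1 -(ortho_det b1) mulrA ab mul1r.
Qed.

End GroupI.

(** * Elements of I and conjugation by products of basis vectors *)

Section CliffordSpin.
Variables (R : realType) (n : nat).
Local Notation Cl := (clifford R n).
Local Notation e i := (delta_mx i 0 : 'cV[R]_n).

Lemma unitvec_delta i : unitvec (e i).
Proof. by rewrite /unitvec dotp_delta mxE !eqxx. Qed.

Lemma clprod_spin (t : seq 'I_n) : ~~ odd (size t) -> clprod R t \in @spin_pred R n.
Proof.
move=> ot; apply/asboolP; exists [seq e i | i <- t]; rewrite size_map; split=> //.
  by apply/allP=> _ /mapP[i _ ->]; exact: unitvec_delta.
by rewrite big_map; apply: eq_bigr => i _; rewrite clvec_delta.
Qed.

Lemma reflmx_delta i k : reflmx (e i) *m e k = (-1) ^+ (k == i) *: e k.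
Proof.
rewrite reflmxE dotp_delta mxE eqxx andbT.
have [->|_] := eqVneq k i; last by rewrite mul0rn scale0r subr0 scale1r.
by rewrite scaleN1r mulr2n scalerDl scale1r opprD addrA subrr add0r.
Qed.

Lemma mulmx_delta_inj m (A B : 'M[R]_(m, n)) :
  (forall k, A *m e k = B *m e k) -> A = B.
Proof.
move=> AB; apply/matrixP=> i k.
by have := congr1 (fun v : 'cV_m => v i 0) (AB k); rewrite -!colE !mxE.
Qed.

(** The diagonal of the change of sign of the coordinates i and j, for i and j
    distinct. *)
Definition pair_signs i j : 'rV[R]_n := \row_k ((-1) ^+ (k == i) * (-1) ^+ (k == j)).

Lemma spin_cover_pair (x : spin R n) i j :
  (x : Cl) = cle R [set i] * cle R [set j] ->
  spin_cover_mx x = diag_mx (pair_signs i j).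
Proof.
move=> xE; rewrite (@spin_cover_prod _ _ x [:: e i; e j]) /= ?unitvec_delta //.
  rewrite expr2 mulrNN mulr1 scale1r mulmx1; apply: mulmx_delta_inj => k.
  rewrite -mulmxA !(reflmx_delta, =^~ scalemxAr) scalerA mulrC.
  apply/colP=> l; rewrite mul_diag_mx !mxE.
  by have [->|] := eqVneq l k; rewrite ?mulr0.
by rewrite big_cons big_seq1 !clvec_delta.
Qed.

Lemma prod_sign_delta (i : 'I_n) : \prod_k (-1) ^+ (k == i) = -1 :> R.
Proof.
by rewrite (bigD1 i) //= eqxx big1 ?mulr1 ?expr1 // => k /negPf ->.
Qed.
End CliffordSpin.

Section ElementsOfI.
Variable R : realType.
Local Notation Spin7 := (spin R 7).
Local Notation Cl := (clifford R 7).
Local Notation e i := (delta_mx i 0 : 'cV[R]_(3 + 3 + 1)).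
Local Notation iF i := (lshift 1 i : 'I_(3 + 3 + 1)).

(** If i and j are in the same half of F, the determinants of the sign change on
    T and T' are 1 and 1, and otherwise they are -1 and -1. *)
Lemma pair_inI (i j : 'I_(3 + 3)) : i != j ->
  exists y : Igroup R, (rho R y : Cl) = cle R [set iF i] * cle R [set iF j].
Proof.
move=> ij.
have xS : clprod R [:: iF i; iF j] \in @spin_pred R 7 by exact: clprod_spin.
have xE : (Spin xS : Cl) = cle R [set iF i] * cle R [set iF j].
  by rewrite /= /clprod big_cons big_seq1.
have soE : so_mx (Spin xS) = diag_mx (pair_signs R (iF i) (iF j)).
  exact: spin_cover_pair xE.
pose d := pair_signs R i j; pose a := diag_mx (lsubmx d); pose b := diag_mx (rsubmx d).
have dE : diag_mx d = block_mx a 0 0 b by rewrite -diag_mx_row hsubmxK.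
have sq (c : bool) : (-1) ^+ c * (-1) ^+ c = 1 :> R by rewrite -expr2 sqrr_sign.
have dd k : d 0 k * d 0 k = 1 by rewrite mxE mulrACA !sq mulr1.
have diag_ortho m (r : 'rV[R]_m) : (forall k, r 0 k * r 0 k = 1) -> is_ortho (diag_mx r).
  move=> r1; rewrite /is_ortho tr_diag_mx mulmx_diag -diag_const_mx.
  by congr diag_mx; apply/rowP=> k; rewrite !mxE r1.
have a1 : is_ortho a by apply: diag_ortho => k; rewrite mxE dd.
have b1 : is_ortho b by apply: diag_ortho => k; rewrite mxE dd.
have ddet : \det (diag_mx d) = 1.
  rewrite det_diag (eq_bigr (fun k => (-1) ^+ (k == i) * (-1) ^+ (k == j))).
    by rewrite big_split /= !prod_sign_delta mulrNN mulr1.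
  by move=> k _; rewrite mxE.
have ab : \det a = \det b.
  move: ddet; rewrite dE det_ublock => ab.
  by rewrite -[LHS]mulr1 -(ortho_det b1) mulrA ab mul1r.
have [A AE] := inIbar_fix a1 b1 ab.
have [|y yx yA] := @inI_ex R (Spin xS) A; last by exists y; rewrite yx.
rewrite soE AE -dE /extF ddet.
rewrite [X in block_mx _ _ _ X](_ : _ = diag_mx (const_mx 1)); last first.
  by rewrite diag_const_mx.
rewrite -diag_mx_row; congr diag_mx; apply/rowP=> k.
rewrite !mxE; case: (split_ordP k) => l ->.
  by rewrite !mxE !(inj_eq (@lshift_inj _ _)).
by rewrite !mxE !eq_rlshift mulr1.
Qed.

Lemma spin_signE (b : pm1) (x : Spin7) :
  ((spin_sign R b * x)%g : Cl) = pmval R b *: (x : Cl).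
Proof.
rewrite /= /pmval; case: b; rewrite ?expr1 ?expr0 ?mul1r ?scale1r //.
by rewrite mulN1r scaleN1r.
Qed.

Lemma spin_conjE (k x y : Spin7) :
  (y = k * x * k^-1)%g <-> (y : Cl) * (k : Cl) = (k : Cl) * (x : Cl).
Proof.
have kU : (k : Cl) \is a GRing.unit by exact: spin_unit (valP k).
split=> [->|yk] /=; first by rewrite mulrVK.
by apply/val_inj; rewrite /= -yk mulrK.
Qed.

Lemma so_mx_sign (b : pm1) (x : Spin7) : so_mx (spin_sign R b * x)%g = so_mx x.
Proof.
rewrite so_mxM; suff -> : so_mx (spin_sign R b) = 1%:M by rewrite mul1mx.
apply: spin_cover_uniq => v; rewrite mul1mx /= /pmval.
by case: b; rewrite ?expr1 ?expr0 ?invrN ?invr1 ?mulrN1 ?mulN1r ?opprK ?mulr1 ?mul1r.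
Qed.

(** The form in which [spin_conj_clprod] yields conjugacy of x and b x by a
    product of an even number of basis vectors. *)
Lemma conjugate_sign (g x : Spin7) (t : seq 'I_(3 + 3 + 1))
    (M : 'M[R]_(3 + 3 + 1)) (b : pm1) :
    (g : Cl) = clprod R t -> uniq t -> is_ortho M -> \det M = pmval R b ->
    (forall i, i \in t -> M *m e i = so_mx x *m e i) ->
    (forall i, i \notin t -> M *m e i = e i) ->
  (spin_sign R b * x = g * x * g^-1)%g.
Proof.
move=> gE ut M1 dM Mt MnT; apply/spin_conjE; rewrite spin_signE gE -scalerAl.
have /= -> := @spin_conj_clprod R 7 x M t ut M1 Mt MnT.
rewrite dM -scalerAl scalerA -pmvalM.
by rewrite [(b * b)%g]addbb /pmval scale1r.
Qed.

Lemma block_mx_delta (m n : nat) (a : 'M[R]_m) (d : 'M[R]_n) :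
  (forall i, block_mx a 0 0 d *m delta_mx (lshift n i) (0 : 'I_1)
             = col_mx (a *m delta_mx i 0) 0) *
  (forall i, block_mx a 0 0 d *m delta_mx (rshift m i) (0 : 'I_1)
             = col_mx 0 (d *m delta_mx i 0)).
Proof.
split=> i; rewrite ?delta_mx_ushift ?delta_mx_dshift mul_block_col;
by rewrite !(mulmx0, mul0mx, addr0, add0r).
Qed.

Lemma block1_ortho m n (a : 'M[R]_m) : is_ortho a ->
  is_ortho (block_mx a 0 0 (1%:M : 'M[R]_n)).
Proof.
move=> a1; rewrite /is_ortho tr_block_mx mulmx_block !trmx0 trmx1 a1.
by rewrite !(mul0mx, mulmx0, addr0, add0r, mulmx1) -scalar_mx_block.
Qed.

Definition idxF : seq 'I_(3 + 3 + 1) := [seq iF i | i : 'I_(3 + 3)].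
Definition idxTL : seq 'I_(3 + 3 + 1) :=
  rshift (3 + 3) 0 :: [seq iF (lshift 3 i) | i : 'I_3].

Lemma idxF_spin : clprod R idxF \in @spin_pred R 7.
Proof. by apply: clprod_spin; rewrite size_map size_enum_ord. Qed.
Lemma idxTL_spin : clprod R idxTL \in @spin_pred R 7.
Proof. by apply: clprod_spin; rewrite /= size_map size_enum_ord. Qed.

(** The subspace F is preserved by I, with determinant alpha. *)
Lemma conj_alpha (y : Igroup R) : let g := Spin idxF_spin in
  (spin_sign R (inflate (alpha_bar R) y) * rho R y = g * rho R y * g^-1)%g.
Proof.
move=> g; set a : 'M_(3 + 3) := I_to_Ibar y.
have a1 : is_ortho a by exact: Ibar_ortho.
have yE := so_mx_rho y; rewrite -/a in yE.
apply: (@conjugate_sign g _ idxF (block_mx a 0 0 1%:M)) => //.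
- by rewrite map_inj_uniq ?enum_uniq //; exact: lshift_inj.
- exact: (@block1_ortho _ 1 _ a1).
- by rewrite det_ublock det1 mulr1 -alpha_det.
- move=> _ /imageP[i _ ->]; rewrite yE.
  by rewrite /extF [LHS]block_mx_delta [RHS]block_mx_delta.
- move=> i; case: (split_ordP i) => k ->.
    by rewrite image_f.
  by rewrite [LHS]block_mx_delta mul1mx [RHS]delta_mx_dshift.
Qed.

(** On the kernel of alpha, T + L is preserved with the determinant of T, which
    is eps there. The line L is only added to have an even number of vectors. *)
Lemma conj_eps (eps : {multiplicative Ibar R -> pm1}) (y : Igroup R) :
    extends_detT eps -> inflate (alpha_bar R) y = 1%g -> let g := Spin idxTL_spin in
  (spin_sign R (inflate eps y) * rho R y = g * rho R y * g^-1)%g.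
Proof.
move=> Heps y1 g; have [a [b [yE a1 b1 ab]]] := Ibar_fixP y1.
have epsE : pmval R (inflate eps y) = \det a by rewrite Heps // yE block_mxKul.
have so : so_mx (rho R y) = block_mx (block_mx a 0 0 b) 0 0 1%:M.
  by rewrite so_mx_rho /extF yE det_ublock ab ortho_det.
pose M : 'M[R]_(3 + 3 + 1) := block_mx (block_mx a 0 0 1%:M) 0 0 1%:M.
apply: (@conjugate_sign g _ idxTL M); rewrite /M //.
- rewrite /= map_inj_uniq ?enum_uniq ?andbT.
    by apply/imageP=> -[i _ /eqP]; rewrite eq_rlshift.
  by move=> i j /lshift_inj/lshift_inj.
- exact: (@block1_ortho _ 1 _ (@block1_ortho _ 3 _ a1)).
- by rewrite !det_ublock !det1 !mulr1.
- move=> i; rewrite so inE => /predU1P[->|/imageP[k _ ->]].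
    by rewrite [LHS]block_mx_delta [RHS]block_mx_delta.
  by rewrite [LHS]block_mx_delta [RHS]block_mx_delta !block_mx_delta.
- move=> i; case: (split_ordP i) => k ->; last first.
    by rewrite ord1 inE eqxx.
  case: (split_ordP k) => l ->.
    by rewrite inE [X in _ || X](image_f (fun i : 'I_3 => iF (lshift 3 i))) ?orbT.
  move=> _; rewrite [LHS]block_mx_delta block_mx_delta mul1mx.
  by rewrite [RHS]delta_mx_ushift delta_mx_dshift.
Qed.
End ElementsOfI.

(** * The inclusion of I is unacceptable of type IIIb *)

Lemma char_div_ker (G : groupType) (chi : {multiplicative G -> pm1}) x s :
  chi x <> 1%g -> chi s <> 1%g -> chi (x * s^-1)%g = 1%g.
Proof.
move=> x1 s1; have : chi (x * s^-1 * s)%g = chi x by rewrite mulgVK.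
rewrite gmulfM; move: x1 s1; move: (chi x) (chi s) (chi (x / s)%g).
by do 3!case.
Qed.

Section Inclusion.
Variable R : realType.
Local Notation Spin7 := (spin R 7).
Local Notation Cl := (clifford R 7).
Local Notation e i := (delta_mx i 0 : 'cV[R]_(3 + 3 + 1)).
Local Notation iF i := (lshift 1 i : 'I_(3 + 3 + 1)).
Local Notation iT i := (lshift 1 (lshift 3 i) : 'I_(3 + 3 + 1)).
Local Notation iT' i := (lshift 1 (rshift 3 i) : 'I_(3 + 3 + 1)).
Local Notation iL := (rshift (3 + 3) 0 : 'I_(3 + 3 + 1)).

Lemma swap_inI : exists y : Igroup R,
  (I_to_Ibar y : 'M[R]_(3 + 3)) = block_mx 0 1%:M 1%:M 0.
Proof.
have o1 : is_ortho (1%:M : 'M[R]_3) by rewrite /is_ortho trmx1 mulmx1.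
have [A AE] := inIbar_swap o1 o1 erefl.
by have [y yA] := I_lift A; exists y; rewrite yA.
Qed.

Lemma so_mx_swap (y : Igroup R) :
    (I_to_Ibar y : 'M[R]_(3 + 3)) = block_mx 0 1%:M 1%:M 0 ->
  so_mx (rho R y) = block_mx (block_mx 0 1%:M 1%:M 0) 0 0 (- 1%:M).
Proof.
move=> yE; rewrite so_mx_rho yE /extF det_swap_block !det1 mulr1.
by rewrite raddfN.
Qed.

Lemma so_mx_pair (y : Igroup R) i j :
  (rho R y : Cl) = cle R [set iF i] * cle R [set iF j] ->
  so_mx (rho R y) = diag_mx (pair_signs R (iF i) (iF j)).
Proof. by move=> yE; apply: spin_cover_pair. Qed.

Lemma alpha_pair (y : Igroup R) i j : i != j ->
  (rho R y : Cl) = cle R [set iF i] * cle R [set iF j] ->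
  inflate (alpha_bar R) y = 1%g.
Proof.
move=> ij /so_mx_pair yE; apply: (@pmval_inj R); rewrite alpha_det pmval1.
have := congr1 (fun M : 'M_(3 + 3 + 1) => M iL iL) (so_mx_rho y).
rewrite yE /extF block_mxEdr !mxE eqxx !mulr1n => <-.
by rewrite !eq_rlshift mulr1.
Qed.

(** Every coordinate is changed in sign by some element of I: the pairs e_i e_j
    take care of F and the exchange of T and T' of L. *)
Lemma I_fixed_vector0 (v : 'cV[R]_(3 + 3 + 1)) :
  (forall y : Igroup R, so_mx (rho R y) *m v = v) -> v = 0.
Proof.
move=> vI; apply/colP=> k; rewrite [RHS]mxE.
suff : v k 0 = - v k 0.
  by move/eqP; rewrite -addr_eq0 -mulr2n mulrn_eq0 => /eqP.
case: (split_ordP k) => i ->; last first.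
  have [y /so_mx_swap yE] := swap_inI.
  rewrite -{1}(vI y) yE -{1}[v]vsubmxK mul_block_col col_mxEd.
  by rewrite mul0mx add0r mulNmx mul1mx !mxE.
have [j ij] : exists j : 'I_(3 + 3), i != j.
  have [->|i0] := eqVneq i 0; last by exists 0.
  by exists (lift 0 (0 : 'I_5)).
have [y /so_mx_pair yE] := pair_inI R ij.
rewrite -{1}(vI y) yE mul_diag_mx !mxE !(inj_eq (@lshift_inj _ _)) eqxx (negPf ij).
by rewrite expr1 mulr1 mulN1r.
Qed.

Lemma eps_pair (eps : {multiplicative Ibar R -> pm1}) (y : Igroup R) (i : 'I_3) (j : 'I_3) :
  extends_detT eps ->
  (rho R y : Cl) = cle R [set iT i] * cle R [set iT' j] ->
  pmval R (inflate eps y) = -1.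
Proof.
move=> Heps yE; have a1 : inflate (alpha_bar R) y = 1%g.
  by apply: alpha_pair yE; rewrite eq_lrshift.
rewrite Heps //.
have -> : (I_to_Ibar y : 'M[R]_(3 + 3)) = ulsubmx (so_mx (rho R y)).
  by rewrite so_mx_rho block_mxKul.
rewrite (so_mx_pair yE) -[RHS](prod_sign_delta R i).
rewrite (_ : ulsubmx _ = diag_mx (\row_k (-1) ^+ (k == i))).
  by rewrite det_diag; apply: eq_bigr => k _; rewrite mxE.
apply/matrixP=> k l; rewrite !mxE !(inj_eq (@lshift_inj _ _)) eq_lrshift mulr1.
by [].
Qed.

(** Commuting with the change of sign of the coordinates i and j prevents a
    matrix from mixing them with the others. *)
Lemma commutes_pair (K : 'M[R]_(3 + 3 + 1)) i j m :
  i != j ->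
  K *m diag_mx (pair_signs R (iF i) (iF j)) = diag_mx (pair_signs R (iF i) (iF j)) *m K ->
  m != iF i -> m != iF j -> K m (iF i) = 0.
Proof.
move=> ij /matrixP/(_ m (iF i)); rewrite mul_mx_diag mul_diag_mx !mxE eqxx.
rewrite (inj_eq (@lshift_inj _ _)) (negPf ij) => E /negPf mi /negPf mj; move: E.
rewrite mi mj !mulr1 mul1r expr1 mulrN1 => /esym/eqP.
by rewrite -addr_eq0 -mulr2n mulrn_eq0 => /eqP.
Qed.

(** A conjugating element k covers an isometry K that commutes with everything
    covered by I. The sign changes of the coordinates 0, 1 and 0, 2 show that
    e_0 is an eigenvector of K, and the exchange of T and T' that e_3 is one for
    the same eigenvalue c. As c * c = 1, k commutes with e_0 e_3, where eps is
    -1. *)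
Lemma rho_not_conj (eps : {multiplicative Ibar R -> pm1}) : extends_detT eps ->
  ~ hom_conjugate (rho R) (twist (inflate eps) (rho R)).
Proof.
move=> Heps [k Hk]; pose K := so_mx k.
have comm y : K *m so_mx (rho R y) = so_mx (rho R y) *m K.
  have := congr1 (@so_mx R) (Hk y); rewrite so_mx_sign !so_mxM so_mxV => E.
  rewrite [X in _ = X *m _]E -[RHS]mulmxA; have -> : (so_mx k)^T *m K = 1%:M by exact: so_mx_ortho.
  by rewrite mulmx1.
pose c := K (iT 0) (iT 0).
(* e_0 is an eigenvector: the two pairs leave no other coordinate. *)
have K0 : K *m e (iT 0) = c *: e (iT 0).
  rewrite -colE; apply/colP=> m; rewrite mxE [RHS]mxE [delta_mx _ _ _ _]mxE eqxx andbT.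
  have [->|m0] := eqVneq m (iT 0); first by rewrite mulr1.
  rewrite mulr0.
  have key (j : 'I_(3 + 3)) : lshift 3 0 != j -> m != iF j -> K m (iT 0) = 0.
    move=> ij mj; have [y /so_mx_pair yE] := pair_inI R ij.
    by apply: (commutes_pair ij _ m0 mj); rewrite -yE comm.
  have [m1|m1] := eqVneq m (iT 1); last by apply: (key (lshift 3 1)).
  by apply: (key (lshift 3 2)); rewrite ?m1.
have c1 : c * c = 1.
  have := dotp_ortho (e (iT 0)) (e (iT 0)) (so_mx_ortho k).
  rewrite -/K K0 dotpZl dotpC dotpZl dotp_delta mxE !eqxx.
  by rewrite mulr1.
(* The exchange of T and T' transports this to e_3. *)
have K3 : K *m e (iT' 0) = c *: e (iT' 0).
  have [s /so_mx_swap sE] := swap_inI.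
  have se : so_mx (rho R s) *m e (iT 0) = e (iT' 0).
    rewrite sE [LHS]block_mx_delta [RHS]delta_mx_ushift; congr col_mx.
    rewrite delta_mx_ushift delta_mx_dshift mul_block_col.
    by rewrite !(mul0mx, mul1mx, mulmx0, addr0, add0r).
  by rewrite -se mulmxA comm -mulmxA K0 -scalemxAr.
have [|y yE] := @pair_inI R (lshift 3 0) (rshift 3 0); first by rewrite eq_lrshift.
have /spin_conjE := Hk y; rewrite spin_signE (eps_pair Heps yE) scaleN1r yE.
have kU : (k : Cl) \is a GRing.unit by exact: spin_unit (valP k).
have kc i : K *m e i = c *: e i ->
    (k : Cl) * cle R [set i] = c *: (cle R [set i] * (k : Cl)).
  move=> Ki; rewrite -clvec_delta; have := spin_coverP k (e i).
  have -> : spin_cover_mx k *m e i = c *: e i by exact: Ki.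
  by move=> /(congr1 (fun z => z * (k : Cl))); rewrite mulrVK // => ->; rewrite linearZ scalerAl.
rewrite mulrA (kc _ K0) -scalerAl -mulrA (kc _ K3) -scalerAr scalerA c1 scale1r mulrA mulNr.
move=> /esym/eqP; rewrite -addr_eq0 -mulr2n -scaler_nat scaler_eq0 pnatr_eq0 /=.
rewrite -yE => /eqP/(congr1 (fun z => z * (k : Cl)^-1)); rewrite mulrK // mul0r => y0.
have := spin_unit (valP (rho R y)); rewrite [val _]y0.
by rewrite unitr0.
Qed.

(** Where alpha is -1 and eps is -1, the two characters coincide, so
    [conj_alpha] applies. *)
Lemma rho_conjugate_twist (eps : {multiplicative Ibar R -> pm1}) : extends_detT eps ->
  forall y, conjugate (rho R y) (twist (inflate eps) (rho R) y).
Proof.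
move=> Heps y; rewrite /= /twist_fun.
have [ay|ay] := eqVneq (inflate (alpha_bar R) y) 1%g.
  by exists (Spin (idxTL_spin R)); exact: conj_eps.
have [e1|e1] := eqVneq (inflate eps y) 1%g.
  exists 1%g; rewrite e1 invg1 mulg1 mul1g; apply/val_inj.
  by have := spin_signE 1%g (rho R y); rewrite pmval1 scale1r.
exists (Spin (idxF_spin R)); rewrite -conj_alpha; congr (spin_sign R _ * _)%g.
by move: ay e1; do 2!case: (inflate _ _).
Qed.

Lemma rho_restr_acceptable (eps : {multiplicative Ibar R -> pm1}) : extends_detT eps ->
  acceptable (restr_ker (inflate (alpha_bar R)) (rho R))
             (restr_ker (inflate (alpha_bar R)) (inflate eps)).
Proof.
move=> Heps [_]; apply; exists (Spin (idxTL_spin R)) => h.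
have := valP h; rewrite inE => /eqP hE. exact: (conj_eps Heps hE).
Qed.

Lemma linear_cV_mx (m n : nat) (f : {linear 'cV[R]_m -> 'cV[R]_n}) :
  exists M : 'M[R]_(n, m), forall v, f v = M *m v.
Proof.
exists (\matrix_(i, j) f (delta_mx j 0) i 0) => v.
rewrite [in LHS](_ : v = \sum_j v j 0 *: delta_mx j 0); last first.
  rewrite {1}[v]matrix_sum_delta; apply: eq_bigr => j _.
  by rewrite big_ord1.
rewrite linear_sum; apply/colP=> i; rewrite summxE mxE; apply: eq_bigr => j _.
by rewrite linearZ !mxE mulrC.
Qed.

Definition F_mx (y : Igroup R) : 'M[R]_(3 + 3) := I_to_Ibar y.
Fact F_mx1 : F_mx 1%g = 1%:M. Proof. by rewrite /F_mx gmorph1. Qed.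
Fact F_mxM y z : F_mx (y * z)%g = F_mx y *m F_mx z.
Proof. by rewrite /F_mx gmulfM. Qed.
Definition F_repr : mxrepr R (Igroup R) (3 + 3) := MxRepr F_mx1 F_mxM.

Local Notation I0 := (ker (inflate (alpha_bar R))).

Definition T_mx (h : I0) : 'M[R]_3 := ulsubmx (F_mx (val h)).

Lemma F_mx_I0 (h : I0) : exists b, F_mx (val h) = block_mx (T_mx h) 0 0 b.
Proof.
have [|a [b [hE _ _ _]]] := @Ibar_fixP R (I_to_Ibar (val h)).
  by have := valP h; rewrite inE => /eqP.
by exists b; rewrite /T_mx /F_mx hE block_mxKul.
Qed.

Fact T_mx1 : T_mx 1%g = 1%:M.
Proof. by rewrite /T_mx gmorph1 F_mx1 scalar_mx_block block_mxKul. Qed.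
Fact T_mxM g h : T_mx (g * h)%g = T_mx g *m T_mx h.
Proof.
rewrite {1}/T_mx gmulfM F_mxM; have [b ->] := F_mx_I0 g; have [b' ->] := F_mx_I0 h.
by rewrite mulmx_block block_mxKul mul0mx addr0.
Qed.
Definition T_repr : mxrepr R I0 3 := MxRepr T_mx1 T_mxM.
Local Notation Fmod := (mxmodule F_repr).
Local Notation Tmod := (mxmodule T_repr).

Lemma alpha_swap (s : Igroup R) :
    (I_to_Ibar s : 'M[R]_(3 + 3)) = block_mx 0 1%:M 1%:M 0 ->
  inflate (alpha_bar R) s <> 1%g.
Proof.
move=> sE /(congr1 (pmval R)).
rewrite alpha_det sE det_swap_block !det1 mulr1 pmval1 => /eqP.
by rewrite eq_sym oneN1.
Qed.

Lemma nontrivial_alpha : nontrivial (inflate (alpha_bar R)).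
Proof. by have [s sE] := swap_inI; exists s; apply: alpha_swap. Qed.

Lemma nontrivial_eps (eps : {multiplicative Ibar R -> pm1}) : extends_detT eps ->
  nontrivial (inflate eps).
Proof.
move=> Heps; have [|y yE] := @pair_inI R (lshift 3 0) (rshift 3 0).
  by rewrite eq_lrshift.
exists y => y1; have := eps_pair Heps yE; rewrite y1 pmval1 => /eqP.
by rewrite oneN1.
Qed.


Lemma std_contains_alpha :
  contains (stdmodule (rho R)) (charmodule R (inflate (alpha_bar R))).
Proof.
pose f (a : R^o) : 'cV[R]_7 := a *: e iL.
have f_lin : linear f by move=> a b c; rewrite /f scalerDl scalerA.
pose fL : {linear R^o -> 'cV[R]_7} :=
  HB.pack f (GRing.isLinear.Build R R^o 'cV[R]_7 _ f f_lin).
exists fL; split.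
  move=> y a.
  have -> : fL a = a *: e iL by [].
  have -> : fL (ract (charmodule R (inflate (alpha_bar R))) y a)
    = (pmval R (inflate (alpha_bar R) y) * a) *: e iL by [].
  have -> : ract (stdmodule (rho R)) y (a *: e iL) = so_mx (rho R y) *m (a *: e iL) by [].
  have eL : so_mx (rho R y) *m e iL = pmval R (inflate (alpha_bar R) y) *: e iL.
    rewrite so_mx_rho [LHS]block_mx_delta -alpha_det mul_scalar_mx.
    by rewrite delta_mx_dshift scale_col_mx scaler0.
  by rewrite -scalemxAr eL scalerA mulrC.
move=> a b /(congr1 (fun v : 'cV_(3 + 3 + 1) => v iL 0)).
by rewrite !mxE eqxx !mulr1.
Qed.

Lemma std_no_trivial :
  ~ contains (stdmodule (rho R)) (charmodule R (trivial_char (Igroup R))).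
Proof.
move=> [f [fh finj]]; have f1 : f (1 : R^o) = 0.
  apply: (@I_fixed_vector0 (f (1 : R^o))) => y.
  rewrite -[RHS](_ : f (ract (charmodule R (trivial_char _)) y 1) = _).
    exact/esym/fh.
  by congr (f _); exact: scale1r.
by have /eqP := finj 1 0 (etrans f1 (esym (linear0 f))); rewrite oner_eq0.
Qed.

Lemma std_decomp :
  risom (stdmodule (rho R)) (rsum Fmod (charmodule R (inflate (alpha_bar R)))).
Proof.
pose f (v : 'cV[R]_(3 + 3 + 1)) : 'cV[R]_(3 + 3) * R^o := (usubmx v, dsubmx v 0 0).
have f_lin : linear f.
  by move=> a v w; rewrite /f; congr pair; rewrite ?linearP // !mxE.
pose fL : {linear 'cV[R]_(3 + 3 + 1) -> ('cV[R]_(3 + 3) * R^o)%type} :=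
  HB.pack f (GRing.isLinear.Build R _ _ _ f f_lin).
exists fL; split.
  suff fM y (v : 'cV[R]_(3 + 3 + 1)) : f (so_mx (rho R y) *m v) =
    (F_mx y *m usubmx v, pmval R (inflate (alpha_bar R) y) * dsubmx v 0 0).
    by move=> y v; exact: fM.
  rewrite /f so_mx_rho /extF -{1 2}[v]vsubmxK mul_block_col col_mxKu col_mxKd.
  by rewrite !mul0mx addr0 add0r -alpha_det mul_scalar_mx [in LHS]mxE.
exists (fun p : 'cV[R]_(3 + 3) * R^o => col_mx p.1 (const_mx p.2)) => [v|[u a]].
  rewrite /= -[RHS]vsubmxK; congr col_mx; apply/colP=> i.
  by rewrite ord1 [LHS]mxE.
by rewrite /= /f col_mxKu col_mxKd mxE.
Qed.

Lemma rres_contains_T : contains (rres (val : I0 -> Igroup R) Fmod) Tmod.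
Proof.
pose f (v : 'cV[R]_3) : 'cV[R]_(3 + 3) := col_mx v 0.
have f_lin : linear f.
  by move=> a v w; rewrite /f scale_col_mx add_col_mx scaler0 addr0.
pose fL : {linear 'cV[R]_3 -> 'cV[R]_(3 + 3)} :=
  HB.pack f (GRing.isLinear.Build R _ _ _ f f_lin).
exists fL; split.
  move=> h v; have -> : fL (ract Tmod h v) = f (T_mx h *m v) by [].
  have -> : ract (rres (val : I0 -> Igroup R) Fmod) h (fL v) = F_mx (val h) *m f v by [].
  have [b ->] := F_mx_I0 h.
  by rewrite /f mul_block_col !mulmx0 mul0mx !addr0.
move=> v w; have E (u : 'cV_3) : fL u = f u by [].
by rewrite !E /f => /eq_col_mx[].
Qed.

(** The map of Frobenius reciprocity for the projection from F to T. It is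
    bijective because the values of a function of the induced module at 1 and at
    the exchange s of T and T' determine it, and are the components in T and T'
    of the vector that it comes from. *)
Lemma F_induced : risom Fmod (rind (val : I0 -> Igroup R) Tmod).
Proof.
pose pT (v : 'cV[R]_(3 + 3)) : 'cV[R]_3 := usubmx v.
pose i0 : {multiplicative I0 -> Igroup R} := val.
have pTh h v : pT (F_mx (val h) *m v) = T_mx h *m pT v.
  have [b ->] := F_mx_I0 h; rewrite /pT -{1}[v]vsubmxK mul_block_col col_mxKu.
  by rewrite mul0mx addr0.
have fP (v : 'cV[R]_(3 + 3)) :
    (fun x : Igroup R => pT (F_mx x *m v)) \in @ind_pred R I0 (Igroup R) i0 Tmod.
  by apply/asboolP=> h x; rewrite F_mxM -mulmxA pTh.
pose f v : @ind_fun R I0 (Igroup R) i0 Tmod := IndFun (fP v).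
have f_lin : linear f.
  move=> a v w; apply/val_inj/funext=> x /=.
  by rewrite [LHS]/pT !linearP.
pose fL : {linear 'cV[R]_(3 + 3) -> @ind_fun R I0 (Igroup R) i0 Tmod} :=
  HB.pack f (GRing.isLinear.Build R _ _ _ f f_lin).
exists fL; split.
  move=> y v; apply/val_inj/funext=> x /=.
  by rewrite F_mxM mulmxA.
have [s sE] := swap_inI.
have sF : F_mx s = block_mx 0 1%:M 1%:M 0 := sE.
have pTs v : pT (F_mx s *m v) = dsubmx v.
  rewrite sF /pT -{1}[v]vsubmxK mul_block_col col_mxKu.
  by rewrite mul0mx mul1mx add0r.
exists (fun p : @ind_fun R I0 (Igroup R) i0 Tmod => col_mx (ind_val p 1%g) (ind_val p s)) => [v|p].
  rewrite /= F_mx1 mul1mx pTs; exact: vsubmxK.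
apply/val_inj/funext=> x /=.
have pI h z : ind_val p (val h * z)%g = T_mx h *m ind_val p z.
  by case: p => p /= /asboolP; apply.
have [x1|x1] := eqVneq (inflate (alpha_bar R) x) 1%g.
  have xk : x \in ker_pred (inflate (alpha_bar R)) by rewrite inE x1.
  have -> : x = (val (Ker xk : I0) * 1)%g by rewrite mulg1.
  by rewrite pI F_mxM F_mx1 mulmx1 pTh /pT col_mxKu.
have xk : (x * s^-1)%g \in ker_pred (inflate (alpha_bar R)).
  by rewrite inE; apply/eqP/char_div_ker => //; [exact/eqP | exact: alpha_swap].
have -> : x = (val (Ker xk : I0) * s)%g by rewrite /= mulgVK.
by rewrite pI F_mxM -mulmxA pTh pTs col_mxKd.
Qed.

Theorem rho_unacceptable_IIIb (eps : {multiplicative Ibar R -> pm1}) : extends_detT eps ->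
  unacceptable_IIIb (inflate (alpha_bar R)) (rho R) (inflate eps).
Proof.
move=> Heps; split.
- split; [exact: nontrivial_alpha | exact: std_contains_alpha | exact: std_no_trivial |].
  exists (inflate eps); split; first exact: nontrivial_eps.
    by split; [exact: rho_conjugate_twist | exact: rho_not_conj].
  exact: rho_restr_acceptable.
- exact: nontrivial_eps.
- exact: rho_not_conj.
- exists Fmod; split; first exact: std_decomp.
  exists T_repr; split; [exact: rres_contains_T | | exact: F_induced].
  move=> h; have := valP h; rewrite inE => /eqP h1.
  by rewrite [RHS]Heps.
Qed.
End Inclusion.

(** * Unacceptable pairs of type IIIb factor through I *)

Section Converse.
Variables (R : realType) (Gam : groupType) (chi : {multiplicative Gam -> pm1}).
Variable r : {multiplicative Gam -> spin R 7}.
Variable eta : {multiplicative Gam -> pm1}.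
Local Notation G0 := (ker chi).
Local Notation so x := (so_mx (r x)).

Lemma in_ker x : chi x = 1%g -> exists h : G0, val h = x.
Proof.
move=> x1; have xk : x \in ker_pred chi by rewrite inE x1.
by exists (Ker xk).
Qed.

Lemma ker1 (h : G0) : chi (val h) = 1%g.
Proof. by have := valP h; rewrite inE => /eqP. Qed.

Lemma conj_ker g (h : G0) : exists h' : G0, val h' = (g * val h * g^-1)%g.
Proof.
apply: in_ker; rewrite !gmulfM ker1 mulg1 -gmulfM mulgV; exact: gmorph1.
Qed.

(** A is the isomorphism of the complement of chi with the induced module
    followed by evaluation at 1, and A so(g) is then evaluation at g. The last
    condition holds because a function of the induced module is determined by
    its values at 1 and g, which represent the two cosets of Gam0. The matrix i
    is the embedding of V0 in R^7; it only serves to find an invariant inner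
    product on V0. *)
Lemma IIIb_coordinates g : chi g <> 1%g -> unacceptable_IIIb chi r eta ->
  exists (V0 : mxrepr R G0 3) (i : 'M[R]_(3 + 3 + 1, 3)) (A : 'M[R]_(3, 3 + 3 + 1))
    (l : 'rV[R]_(3 + 3 + 1)),
  [/\ forall h, \det (V0 h) = pmval R (eta (val h)),
      (forall v : 'cV_3, i *m v = 0 -> v = 0) /\
      (forall h, i *m V0 h = so (val h) *m i),
      forall h, A *m so (val h) = V0 h *m A,
      forall x, l *m so x = pmval R (chi x) *: l
    & forall v : 'cV_(3 + 3 + 1), A *m v = 0 -> A *m so g *m v = 0 -> l *m v = 0 -> v = 0].
Proof.
move=> g1 [_ _ _ [U [[phi [phih [phi' phiK phi'K]]] [V0]]]].
move=> [[f [fh finj]] detV [psi [psih [psi' psiK _]]]].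
pose i0 : {multiplicative G0 -> Gam} := val.
have phi_inj := can_inj phiK; have psi_inj := can_inj psiK.
pose p (v : 'cV[R]_(3 + 3 + 1)) : Gam -> 'cV[R]_3 := ind_val (psi (phi v).1).
have pP v (h : G0) x : p v (val h * x)%g = V0 h *m p v x.
  by rewrite /p; case: (psi _) => q /= /asboolP; apply.
have p_so v x y : p (so x *m v) y = p v (y * x)%g.
  have -> : so x *m v = ract (stdmodule r) x v by [].
  by rewrite /p phih /= psih.
have p_lin x : linear (p^~ x).
  move=> a v w; rewrite /p.
  have -> : phi (a *: v + w) = a *: phi v + phi w by exact: linearP.
  by rewrite /= linearP.
pose a1 : {linear 'cV[R]_(3 + 3 + 1) -> 'cV[R]_3} :=
  HB.pack (p^~ 1%g) (GRing.isLinear.Build R _ _ _ (p^~ 1%g) (p_lin 1%g)).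
have [A AE] := linear_cV_mx a1; have {}AE v : p v 1%g = A *m v by exact: AE.
pose q (v : 'cV[R]_(3 + 3 + 1)) : 'cV[R]_1 := const_mx (phi v).2.
have q_lin : linear q.
  move=> a v w; rewrite /q.
  have -> : phi (a *: v + w) = a *: phi v + phi w by exact: linearP.
  by apply/colP=> k; rewrite !mxE.
pose q1 : {linear 'cV[R]_(3 + 3 + 1) -> 'cV[R]_1} :=
  HB.pack q (GRing.isLinear.Build R _ _ _ q q_lin).
have [l lE] := linear_cV_mx q1; have {}lE v : q v = l *m v by exact: lE.
pose j (w : 'cV[R]_3) : 'cV[R]_(3 + 3 + 1) := phi' (f w, 0).
have jE w : phi (j w) = (f w, 0) by exact: phi'K.
have j_lin : linear j.
  move=> a v w; apply: phi_inj; rewrite jE.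
  have -> : phi (a *: j v + j w) = a *: phi (j v) + phi (j w) by exact: linearP.
  rewrite !jE; congr pair; last by rewrite /= scaler0 addr0.
  exact: linearP.
pose j1 : {linear 'cV[R]_3 -> 'cV[R]_(3 + 3 + 1)} :=
  HB.pack j (GRing.isLinear.Build R _ _ _ j j_lin).
have [i iE] := linear_cV_mx j1; have {}iE v : j v = i *m v by exact: iE.
have mx_eq m k (M N : 'M[R]_(m, k)) : (forall v : 'cV_k, M *m v = N *m v) -> M = N.
  by move=> MN; apply: mulmx_delta_inj.
exists V0, i, A, l; split=> //.
- split=> [v iv|h].
    apply: finj; have := jE v; rewrite iE iv.
    have -> : phi 0 = 0 by exact: linear0.
    by move=> [<-]; rewrite linear0.
  apply: mx_eq => v; rewrite -!mulmxA -!iE; apply: phi_inj; rewrite jE.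
  have -> : so (val h) *m j v = ract (stdmodule r) (val h) (j v) by [].
  rewrite phih jE /= /rsum_fun /= [in RHS]scaler0; congr pair.
  exact: fh.
- by move=> h; apply: mx_eq => v; rewrite -!mulmxA -!AE p_so mul1g -[val h]mulg1 pP.
- move=> x; apply: mx_eq => v; rewrite -mulmxA -scalemxAl -!lE.
  have E : phi (so x *m v) = ract (rsum U (charmodule R chi)) x (phi v) by exact: phih.
  by apply/colP=> k; rewrite /q !mxE E.
- move=> v; rewrite -mulmxA -!AE -lE p_so mul1g => pv1 pvg qv.
  have pv x : p v x = 0.
    have [x1|x1] := eqVneq (chi x) 1%g.
      by have [h <-] := in_ker x1; rewrite -[val h]mulg1 pP pv1 mulmx0.
    have [h hE] := in_ker (char_div_ker (elimN eqP x1) g1).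
    by rewrite -[x](mulgVK g) -[(x / g)%g]hE pP pvg mulmx0.
  have v1 : (phi v).1 = 0.
    apply: psi_inj; rewrite linear0; apply/val_inj/funext=> x; exact: pv.
  have v2 : (phi v).2 = 0.
    by have := congr1 (fun M : 'cV_1 => M 0 0) qv; rewrite !mxE.
  apply: phi_inj; have -> : phi 0 = 0 by exact: linear0.
  by case: (phi v) v1 v2 => /= ? ? -> ->.
Qed.

Definition fix_mx (a b : 'M[R]_3) : 'M[R]_(3 + 3 + 1) :=
  block_mx (block_mx a 0 0 b) 0 0 1%:M.
Definition swap_mx (a b : 'M[R]_3) : 'M[R]_(3 + 3 + 1) :=
  block_mx (block_mx 0 a b 0) 0 0 (- 1%:M).

Lemma fix_mx_col k (a b : 'M[R]_3) (M N : 'M[R]_(3, k)) (l : 'rV[R]_k) :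
  fix_mx a b *m col_mx (col_mx M N) l = col_mx (col_mx (a *m M) (b *m N)) l.
Proof.
by rewrite /fix_mx !mul_block_col !(mul0mx, mul1mx, addr0, add0r).
Qed.

Lemma swap_mx_col k (a b : 'M[R]_3) (M N : 'M[R]_(3, k)) (l : 'rV[R]_k) :
  swap_mx a b *m col_mx (col_mx M N) l = col_mx (col_mx (a *m N) (b *m M)) (- l).
Proof.
by rewrite /swap_mx !mul_block_col !(mul0mx, mul1mx, addr0, add0r, mulNmx).
Qed.

Lemma fix_mx_ortho a b : is_ortho a -> is_ortho b -> is_ortho (fix_mx a b).
Proof.
move=> a1 b1; apply: block1_ortho; rewrite /is_ortho tr_block_mx mulmx_block !trmx0.
by rewrite !(mul0mx, mulmx0, addr0, add0r) a1 b1 -scalar_mx_block.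
Qed.

Lemma swap_mx_ortho a b : is_ortho a -> is_ortho b -> is_ortho (swap_mx a b).
Proof.
move=> a1 b1; rewrite /is_ortho /swap_mx !tr_block_mx !mulmx_block !trmx0.
rewrite !(mul0mx, mulmx0, addr0, add0r) a1 b1 [(- _)^T]linearN /= trmx1 mulNmx mulmxN mulmx1 opprK.
by rewrite -scalar_mx_block -scalar_mx_block.
Qed.

(** In the coordinates A, A so(g), l of [IIIb_coordinates], after a change of
    basis of V0 that makes it orthogonal, the matrices of r(x) are orthogonal
    block matrices, with V0(x) and V0(g x g^-1) on the diagonal when chi(x) = 1,
    and V0(x g^-1) and V0(g x) off the diagonal otherwise. The block of r(g) that
    is V0(1) = 1 is recorded to compute the value of eps at g. *)
Lemma IIIb_orthogonal_coordinates g : chi g <> 1%g -> unacceptable_IIIb chi r eta ->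
  exists2 Q : 'M[R]_(3 + 3 + 1), is_ortho Q &
    (forall x, chi x = 1%g -> exists a b, [/\ is_ortho a, is_ortho b,
       \det a = pmval R (eta x) & Q *m so x = fix_mx a b *m Q]) /\
    (forall x, chi x <> 1%g -> exists a b, [/\ is_ortho a, is_ortho b,
       (x = g -> a = 1%:M) & Q *m so x = swap_mx a b *m Q]).
Proof.
move=> g1 H; have [V0 [i [A [l [dV [i_inj iV] AV lx inj]]]]] := IIIb_coordinates g1 H.
have [C Cu CV] := orthogonalizable i_inj.
pose V h := C *m V0 h *m invmx C.
have V1 h : is_ortho (V h) by apply: CV (iV h); exact: so_mx_ortho.
have dV' h : \det (V h) = pmval R (eta (val h)).
  by rewrite -dV !det_mulmx det_inv mulrAC divff ?mul1r // -unitfE -unitmxE.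
pose M := C *m A; pose N := M *m so g.
have MV h : M *m so (val h) = V h *m M.
  by rewrite /M /V -mulmxA AV -[RHS]mulmxA mulKmx // mulmxA.
pose X : 'M[R]_(3 + 3 + 1) := col_mx (col_mx M N) l.
have Xu : X \in unitmx.
  apply: inj_unitmx => v; rewrite !mul_col_mx.
  rewrite -[0]vsubmxK => /eq_col_mx[]; rewrite -[usubmx 0]vsubmxK => /eq_col_mx[].
  rewrite !linear0 /N /M -!mulmxA => /(congr1 (mulmx (invmx C))).
  rewrite mulmx0 mulKmx // => Av /(congr1 (mulmx (invmx C))).
  by rewrite mulmx0 mulKmx // mulmxA => Agv lv; rewrite !col_mx0; apply: inj.
have [Q Q1 QE0] := @orthogonal_equiv R 6 X Xu.
have QE (E : 'M[R]_(3 + 3 + 1)) x : is_ortho E -> X *m so x = E *m X ->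
    Q *m so x = E *m Q by move=> E1; apply: QE0 => //; exact: so_mx_ortho.
exists Q => //; split=> x x1.
  have [h hx] := in_ker x1; have [h' h'x] := conj_ker g h.
  exists (V h), (V h'); split=> //; first by rewrite dV' hx.
  apply: QE; first exact: fix_mx_ortho.
  rewrite /X fix_mx_col -hx !mul_col_mx MV; congr (col_mx (col_mx _ _) _).
    by rewrite /N mulmxA -MV h'x -!mulmxA -!so_mxM -!gmulfM mulgVK.
  by rewrite lx hx x1 scale1r.
have [h hE] := in_ker (char_div_ker x1 g1).
have [h' h'E] : exists h' : G0, val h' = (g * x)%g.
  apply: in_ker; rewrite gmulfM; move: x1 g1.
  by move: (chi x) (chi g); do 2!case.
exists (V h), (V h'); split=> //.
  move=> xg; have -> : h = 1%g by apply/val_inj; rewrite hE xg mulgV.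
  by rewrite /V mxr1 mulmx1 mulmxV.
apply: QE; first exact: swap_mx_ortho.
rewrite /X swap_mx_col !mul_col_mx; congr (col_mx (col_mx _ _) _).
- by rewrite /N mulmxA -MV hE -!mulmxA -!so_mxM -!gmulfM mulgVK.
- by rewrite -MV h'E gmulfM so_mxM mulmxA.
- by rewrite lx pmvalN1 // scaleN1r.
Qed.

(** The product with the exchange S of T and T' is in the kernel of alpha, where
    eps is the determinant of T. So eps is known once eps(S) is. *)
Lemma eps_swap (eps : {multiplicative Ibar R -> pm1}) (S A : Ibar R) (a b : 'M[R]_3) :
    extends_detT eps -> (S : 'M[R]_(3 + 3)) = block_mx 0 1%:M 1%:M 0 ->
    (A : 'M[R]_(3 + 3)) = block_mx 0 a b 0 ->
    is_ortho a -> is_ortho b -> \det a = \det b ->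
  pmval R (eps A) = \det a * pmval R (eps S).
Proof.
move=> Heps SE AE a1 b1 ab.
have ASE : ((A * S)%g : 'M[R]_(3 + 3)) = block_mx a 0 0 b.
  have -> : ((A * S)%g : 'M[R]_(3 + 3)) = (A : 'M[R]_(3 + 3)) *m (S : 'M[R]_(3 + 3)).
    by [].
  by rewrite AE SE mulmx_block !(mul0mx, mulmx0, mulmx1, addr0, add0r).
have AS1 : alpha_bar R (A * S)%g = 1%g.
  by apply: (@pmval_inj R); rewrite alpha_det ASE det_ublock ab ortho_det.
have := Heps _ AS1; rewrite ASE block_mxKul gmulfM pmvalM => <-.
by rewrite -mulrA -pmvalM [(eps S * _)%g]addbb mulr1.
Qed.

(** The orthogonal coordinates Q are rescaled by Z: the sign c on T' multiplies
    the off-diagonal blocks by c, hence the values of eps outside of the kernel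
    of chi by c ^+ 3 = c, and it is chosen for eps to agree with eta at g; the
    sign on L then makes the determinant of Z Q equal to 1. *)
Lemma factor_through_I (eps : {multiplicative Ibar R -> pm1}) g :
    extends_detT eps -> chi g <> 1%g -> unacceptable_IIIb chi r eta ->
  exists k : spin R 7, forall x, exists y : Igroup R,
    [/\ rho R y = (k * r x * k^-1)%g, inflate (alpha_bar R) y = chi x
      & chi x = 1%g \/ x = g -> inflate eps y = eta x].
Proof.
move=> Heps g1 /(IIIb_orthogonal_coordinates g1)[Q Q1 [Qfix Qswap]].
have [s sE] := swap_inI R; set S := I_to_Ibar s in sE.
pose c : R := pmval R (eta g * eps S)%g.
have cc : c * c = 1 by rewrite /c -pmvalM [(_ * _)%g]addbb.
have QQ := ortho_det Q1.
pose Z : 'M[R]_(3 + 3 + 1) :=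
  block_mx (block_mx 1%:M 0 0 c%:M) 0 0 (c * \det Q)%:M.
have Zt : Z^T = Z by rewrite /Z !tr_block_mx !trmx0 !tr_scalar_mx.
have scal_ortho m (a : R) : a * a = 1 -> is_ortho (a%:M : 'M[R]_m).
  by move=> aa; rewrite /is_ortho tr_scalar_mx -scalar_mxM aa.
have ZZ : Z *m Z = 1%:M.
  rewrite /Z !mulmx_block !(mul0mx, mulmx0, mulmx1, addr0, add0r) -!scalar_mxM cc.
  by rewrite mulrACA cc QQ mulr1 -!scalar_mx_block.
have dZ : \det Z = \det Q.
  have c3 : c ^+ 3 = c by rewrite exprS expr2 cc mulr1.
  by rewrite /Z !det_ublock det1 det_scalar c3 det_scalar1 mul1r mulrA cc mul1r.
have P1 : is_ortho (Z *m Q).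
  by rewrite /is_ortho trmx_mul -mulmxA [Z^T *m _]mulmxA Zt ZZ mul1mx.
have dP : \det (Z *m Q) = 1 by rewrite det_mulmx dZ.
have [k kE0] := spin_cover_surj P1 dP; have kE : so_mx k = Z *m Q := kE0.
exists k => x.
have kxk (E : 'M[R]_(3 + 3 + 1)) : Q *m so x = E *m Q ->
    so_mx (k * r x * k^-1)%g = Z *m E *m Z.
  move=> QE; rewrite !so_mxM so_mxV kE trmx_mul Zt.
  rewrite -[Z *m Q *m _]mulmxA QE !mulmxA -[_ *m Q *m Q^T]mulmxA.
  by rewrite [Q *m Q^T]mulmx1C // mulmx1.
have so1 := det_so_mx (k * r x * k^-1)%g.
have [x1|/eqP x1] := eqVneq (chi x) 1%g.
  have [a [b [a1 b1 da QE]]] := Qfix x x1; move/kxk: QE => xE.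
  have {}xE : so_mx (k * r x * k^-1)%g = fix_mx a b.
    rewrite xE /Z /fix_mx !(mulmx_block, mul0mx, mulmx0, mul1mx, mulmx1, addr0, add0r).
    rewrite -scalar_mxM mul_scalar_mx mul_mx_scalar scalerA cc scale1r.
    by rewrite mulrACA cc QQ mulr1.
  have ab1 : \det a * \det b = 1 by rewrite -so1 xE !det_ublock det1 mulr1.
  have ab : \det a = \det b.
    by rewrite -[LHS]mulr1 -(ortho_det b1) mulrA ab1 mul1r.
  have [A AE] := inIbar_fix a1 b1 ab.
  have [|y yx yA] := @inI_ex R (k * r x * k^-1)%g A.
    by rewrite xE /extF AE det_ublock ab1.
  have ay : inflate (alpha_bar R) y = 1%g.
    have -> : inflate (alpha_bar R) y = alpha_bar R A by rewrite -yA.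
    by apply: (@pmval_inj R); rewrite alpha_det AE det_ublock ab1.
  exists y; split; rewrite ?x1 // => _; apply: (@pmval_inj R).
  have -> : inflate eps y = eps A by rewrite -yA.
  rewrite Heps; first by rewrite AE block_mxKul.
  by rewrite -yA.
have [a [b [a1 b1 ag QE]]] := Qswap x x1; move/kxk: QE => xE.
have {}xE : so_mx (k * r x * k^-1)%g = swap_mx (c *: a) (c *: b).
  rewrite xE /Z /swap_mx !(mulmx_block, mul0mx, mulmx0, mul1mx, mulmx1, addr0, add0r).
  rewrite mulmxN mulmx1 mulNmx -scalar_mxM mul_scalar_mx mul_mx_scalar.
  by rewrite mulrACA cc QQ mulr1.
have scale_ortho m (a' : 'M[R]_m) : is_ortho a' -> is_ortho (c *: a').
  move=> a'1; rewrite /is_ortho [(c *: _)^T]linearZ /= -scalemxAl -scalemxAr scalerA cc.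
  by rewrite scale1r.
have ab1 : \det (c *: a) * \det (c *: b) = 1.
  rewrite -so1 xE det_ublock det_swap_block (_ : - 1%:M = (-1)%:M); last by rewrite raddfN.
  by rewrite det_scalar1 mulrN1 opprK.
have ab : \det (c *: a) = \det (c *: b).
  by rewrite -[LHS]mulr1 -(ortho_det (scale_ortho _ _ b1)) mulrA ab1 mul1r.
have [A AE] := inIbar_swap (scale_ortho _ _ a1) (scale_ortho _ _ b1) ab.
have [|y yx yA] := @inI_ex R (k * r x * k^-1)%g A.
  by rewrite xE /extF AE det_swap_block ab1 raddfN.
have ay : inflate (alpha_bar R) y = chi x.
  have -> : inflate (alpha_bar R) y = alpha_bar R A by rewrite -yA.
  by apply: (@pmval_inj R); rewrite alpha_det AE det_swap_block ab1 (pmvalN1 R x1).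
exists y; split=> // -[//|xg]; apply: (@pmval_inj R).
have -> : inflate eps y = eps A by rewrite -yA.
rewrite (eps_swap Heps sE AE (scale_ortho _ _ a1) (scale_ortho _ _ b1) ab).
rewrite ag // detZ det1 mulr1 exprS expr2 cc mulr1 /c pmvalM -mulrA -pmvalM.
by rewrite [(eps S * _)%g]addbb mulr1 xg.
Qed.

Lemma rho_inj : injective (rho R).
Proof. by move=> y z /val_inj/val_inj. Qed.
End Converse.

Theorem theorem7p7 (R : realType) (eps : {multiplicative (Ibar R) -> pm1})
    (Heps : extends_detT eps) :
  unacceptable_IIIb (inflate (alpha_bar R)) (rho R) (inflate eps) /\
  (forall (Gam : groupType) (chi : {multiplicative Gam -> pm1})
      (r : {multiplicative Gam -> (spin R 7)}) (eta : {multiplicative Gam -> pm1}),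
    nontrivial chi ->
    unacceptable_IIIb chi r eta ->
    exists (k : spin R 7) (f : {multiplicative Gam -> (Igroup R)}),
      (forall g : Gam, (k * r g * k^-1)%g = rho R (f g)) /\
      (forall g : Gam, chi g = inflate (alpha_bar R) (f g)) /\
      (forall g : Gam, eta g = inflate eps (f g))).
Proof.
split; first exact: rho_unacceptable_IIIb.
move=> Gam chi r eta [g g1] H.
have [k /choice[f0 f0P]] := factor_through_I Heps g1 H.
have f0M : {morph f0 : x y / (x * y)%g}.
  move=> x y; apply: rho_inj; rewrite gmulfM.
  have [-> _ _] := f0P (x * y)%g; have [-> _ _] := f0P x; have [-> _ _] := f0P y.
  by rewrite gmulfM !mulgA mulgVK.
pose f : {multiplicative Gam -> Igroup R} :=
  HB.pack f0 (isMultiplicative.Build Gam (Igroup R) f0 f0M).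
exists k, f; split=> [x|]; first by have [-> _ _] := f0P x.
have chiE x : chi x = inflate (alpha_bar R) (f x) by have [_ -> _] := f0P x.
have etaE x : chi x = 1%g \/ x = g -> eta x = inflate eps (f x).
  by have [_ _ E] := f0P x; move=> /E ->.
split=> // x; have [x1|/eqP x1] := eqVneq (chi x) 1%g; first by apply: etaE; left.
have [z z1 ->] : exists2 z, chi z = 1%g & x = (z * g)%g.
  by exists (x / g)%g; rewrite ?mulgVK //; apply: char_div_ker.
by rewrite !gmulfM -!etaE; [|right|left].
Qed.
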